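(* Let $p\ge1$ and $n\ge2$ be integers and let $f\in L^2(\widehat{S}_p)$. Then $$f(\eta)=\sum_{m=0}^{\infty}\langle f,Z^p_m(\cdot,\eta)\rangle_{\widehat{S}_p}\quad\text{in } L^2(\widehat{S}_p),$$ i.e. the series of functions $\eta\mapsto\langle f,Z^p_m(\cdot,\eta)\rangle_{\widehat{S}_p}$ converges to $f$ in the norm of $L^2(\widehat{S}_p)$.
   Context: $S$ is the unit sphere in $\mathbb{R}^n\subset\mathbb{C}^n$ centred at the origin, $\sigma$ its normalised surface measure ($\sigma(S)=1$), $\widehat{S}_p:=\bigcup_{k=0}^{p-1}e^{\frac{k\pi i}{p}}S\subset\mathbb{C}^n$. $L^2(\widehat{S}_p)$ is the Hilbert space of square-integrable complex functions on $\widehat{S}_p$ with inner product $\langle f,g\rangle_{\widehat{S}_p}:=\frac1p\int_S\sum_{j=0}^{p-1}f(e^{\frac{j\pi i}{p}}\zeta)\overline{g(e^{\frac{j\pi i}{p}}\zeta)}\,d\sigma(\zeta)$. $\mathcal{H}_m^p(\mathbb{C}^n)$ is the space of complex polynomials $u$ on $\mathbb{C}^n$, homogeneous of degree $m$, with $\Delta^pu=0$, $\Delta=\sum_j\partial^2/\partial x_j^2$; $\mathcal{H}_m^p(\widehat{S}_p)$ is the space of their restrictions to $\widehat{S}_p$. For $\eta\in\widehat{S}_p$ the zonal polyharmonic $Z_m^p(\cdot,\eta)$ is the unique element of $\mathcal{H}_m^p(\widehat{S}_p)$ with $q(\eta)=\langle q,Z_m^p(\cdot,\eta)\rangle_{\widehat{S}_p}$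 for all $q\in\mathcal{H}_m^p(\widehat{S}_p)$. *)

(* Defs.v *)
From HB Require Import structures.
From mathcomp Require Import all_boot all_order all_algebra complex.
From mathcomp Require mpoly.

Set Implicit Arguments.
Unset Strict Implicit.
Unset Printing Implicit Defensive.

(* The notations of multinomials and of mathcomp-analysis are incompatible:
   the former are used only inside this module. *)
Module Polyharmonic.
Import mpoly GRing.Theory.
Local Open Scope ring_scope.

Section polyharmonic.
Context (n : nat) (F : comNzRingType).
Implicit Types u : {mpoly F[n]}.

Definition laplacian u : {mpoly F[n]} := \sum_(i < n) u^`M(i)^`M(i).

Definition is_polyharmonic (p m : nat) u : Prop :=
  u \is m.-homog /\ iter p laplacian u = 0.

Definition polyfun u : 'rV[F]_n -> F := fun z => u.@[fun i => z 0 i].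

End polyharmonic.
End Polyharmonic.

From mathcomp Require Import all_classical all_reals all_analysis.
From mathcomp Require Import measurable_realfun.

Import Order.TTheory GRing.Theory Num.Theory.
Import numFieldNormedType.Exports.
Import Polyharmonic.

Local Open Scope classical_set_scope.
Local Open Scope ring_scope.

(** Real space R^n is [n.-tuple R], which carries the product (= Borel)
    sigma-algebra, and complex space C^n is ['rV[R[i]]_n]. *)

Section lebesgue_cons.
Context (R : realType) (n : nat).
Variable m : {sigma_finite_measure set (n.-tuple R) -> \bar R}.

Definition tcons (x : measurableTypeR R * n.-tuple R) : n.+1.-tuple R := [tuple of x.1 :: x.2].

Definition lebesgue_cons : set (n.+1.-tuple R) -> \bar R :=
  pushforward (@lebesgue_measure R \x m)%E tcons.

Let measurable_tcons : measurable_fun setT tcons.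
Proof. exact: measurable_cons. Qed.

Let lebesgue_cons0 : lebesgue_cons set0 = 0%E.
Proof. by rewrite /lebesgue_cons /pushforward preimage_set0 measure0. Qed.

Let lebesgue_cons_ge0 A : (0 <= lebesgue_cons A)%E.
Proof. exact: measure_ge0. Qed.

Let lebesgue_cons_sigma_additive : semi_sigma_additive lebesgue_cons.
Proof.
pose nu := measure_function_pushforward__canonical__measure_function_Measure
  (@lebesgue_measure R \x m)%E measurable_tcons.
exact: (@measure_semi_sigma_additive _ _ _ nu).
Qed.

HB.instance Definition _ := isMeasure.Build _ _ _ lebesgue_cons
  lebesgue_cons0 lebesgue_cons_ge0 lebesgue_cons_sigma_additive.

Let lebesgue_cons_sigma_finite : sigma_finite setT lebesgue_cons.
Proof.
have /sigma_finiteP[F [TF ndF Foo]] := sigma_finiteT (@lebesgue_measure R).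
have /sigma_finiteP[G [TG ndG Goo]] := sigma_finiteT m.
pose tl (t : n.+1.-tuple R) : n.-tuple R := [tuple of behead t].
pose H k := [set t : n.+1.-tuple R | F k (tnth t ord0)] `&`
  [set t | G k (tl t)].
exists H.
  apply/esym; rewrite -subTset => t _.
  have [i _ Fi] : (\bigcup_k F k) (tnth t ord0) by rewrite -TF.
  have [j _ Gj] : (\bigcup_k G k) (tl t) by rewrite -TG.
  exists (maxn i j) => //; split => /=.
    by move: Fi; exact/subsetPset/ndF/leq_maxl.
  by move: Gj; exact/subsetPset/ndG/leq_maxr.
move=> k; have [mF Fk] := Foo k; have [mG Gk] := Goo k; split.
  apply: measurableI; rewrite -[X in measurable X]setTI.
    exact: measurable_tnth.
  exact: measurable_behead.
rewrite /lebesgue_cons /pushforward (_ : tcons @^-1` H k = F k `*` G k).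
  by rewrite product_measure1E// lte_mul_pinfty// ge0_fin_numE.
apply/seteqP; split=> -[x t]; rewrite /H /tcons/=.
  move=> [Fx Gt]; split => //=; move: Gt; congr (G k _); exact/val_inj.
by move=> [Fx Gt]; split => //=; move: Gt; congr (G k _); exact/val_inj.
Qed.

HB.instance Definition _ := Measure_isSigmaFinite.Build _ _ _ lebesgue_cons
  lebesgue_cons_sigma_finite.

End lebesgue_cons.

Fixpoint lebesgue_tuple (R : realType) (n : nat) :
    {sigma_finite_measure set (n.-tuple R) -> \bar R} :=
  if n is k.+1 then lebesgue_cons (lebesgue_tuple R k) else \d_[tuple].

Section sphere.
Context (R : realType) (n : nat).
Implicit Types (x : n.-tuple R) (A : set (n.-tuple R)).

Definition norm2 x : R := Num.sqrt (\sum_(i < n) tnth x i ^+ 2).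

Definition tscale (r : R) x : n.-tuple R := [tuple r * tnth x i | i < n].

Definition sphere : set (n.-tuple R) := [set x | norm2 x = 1].

Definition unit_ball : set (n.-tuple R) := [set x | norm2 x <= 1].

Definition cone A : set (n.-tuple R) :=
  [set x | exists r z, [/\ 0 < r <= 1, sphere z, A z & x = tscale r z]].

(** The surface measure of a part [A] of the sphere is [n] times the Lebesgue
    measure of the cone [{r z | 0 < r <= 1, z in A}] (polar coordinates); after
    normalisation the factor [n] disappears. *)
Definition sphere_measure A : \bar R :=
  (((fine (lebesgue_tuple R n unit_ball))^-1)%:E * lebesgue_tuple R n (cone A))%E.

Let normalise x := tscale (norm2 x)^-1 x.

Let norm2_tscale r x : 0 <= r -> norm2 (tscale r x) = r * norm2 x.
Proof.
move=> r0; rewrite /norm2.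
under eq_bigr do rewrite tnth_mktuple exprMn.
by rewrite -mulr_sumr sqrtrM ?sqr_ge0// sqrtr_sqr ger0_norm.
Qed.

Let tscaleA r s x : tscale r (tscale s x) = tscale (r * s) x.
Proof. by apply: eq_from_tnth => i; rewrite !tnth_mktuple mulrA. Qed.

Let tscale1 x : tscale 1 x = x.
Proof. by apply: eq_from_tnth => i; rewrite !tnth_mktuple mul1r. Qed.

Let coneE A : cone A =
  normalise @^-1` A `&` (@norm2 @^-1` `]0, 1]).
Proof.
apply/seteqP; split => x /=.
  move=> [r [z [/andP[r0 r1] Sz Az ->]]].
  have nr : norm2 (tscale r z) = r by rewrite norm2_tscale ?ltW// Sz mulr1.
  rewrite /normalise nr tscaleA mulVf ?gt_eqF// tscale1; split => //.
  by rewrite in_itv/= r0.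
rewrite in_itv/= => -[Ax /andP[x0 x1]].
exists (norm2 x), (normalise x); split => //; first by rewrite x0.
  by rewrite /sphere/= norm2_tscale ?invr_ge0 ?ltW// mulVf// gt_eqF.
by rewrite tscaleA mulfV ?gt_eqF// tscale1.
Qed.

Let measurable_norm2 : measurable_fun setT norm2.
Proof.
apply: (@measurableT_comp _ _ _ _ _ _ (@Num.sqrt R)).
  by apply: continuous_measurable_fun => z; exact: sqrt_continuous.
apply: measurable_sum => i; apply: measurable_funX; exact: measurable_tnth.
Qed.

Let measurable_normalise : measurable_fun setT normalise.
Proof.
apply/measurable_fun_tnthP => i.
rewrite (_ : _ \o _ = fun x => (norm2 x)^-1 * tnth x i); last first.
  by apply/funext => x /=; rewrite tnth_mktuple.
apply: measurable_funM; last exact: measurable_tnth.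
rewrite (_ : (fun x => _) = fun x => norm2 x `^ (-1)).
  exact: (measurableT_comp (measurable_powR _)).
by apply/funext => x; rewrite powR_inv1// sqrtr_ge0.
Qed.

Let measurable_cone A : measurable A -> measurable (cone A).
Proof.
move=> mA; rewrite coneE; apply: measurableI.
  by rewrite -[X in measurable X]setTI; exact: measurable_normalise.
by rewrite -[X in measurable X]setTI; exact: measurable_norm2.
Qed.

Let volume_ge0 : 0 <= (fine (lebesgue_tuple R n unit_ball))^-1.
Proof. by rewrite invr_ge0 fine_ge0. Qed.

Let sphere_measure0 : sphere_measure set0 = 0%E.
Proof. by rewrite /sphere_measure coneE preimage_set0 set0I measure0 mule0. Qed.

Let sphere_measure_ge0 A : (0 <= sphere_measure A)%E.
Proof. by apply: mule_ge0; rewrite ?lee_fin ?measure_ge0. Qed.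

Let sphere_measure_sigma_additive : semi_sigma_additive sphere_measure.
Proof.
move=> F mF tF mUF.
have -> : sphere_measure (\bigcup_k F k) =
    mscale (NngNum volume_ge0) (lebesgue_tuple R n) (\bigcup_k cone (F k)).
  rewrite /sphere_measure /mscale/= coneE preimage_bigcup setI_bigcupl.
  by congr (_ * lebesgue_tuple R n _)%E; apply: eq_bigcupr => k _; rewrite coneE.
apply: (@measure_semi_sigma_additive _ _ _
  (mscale (NngNum volume_ge0) (lebesgue_tuple R n)) (cone \o F)).
- by move=> k; exact: measurable_cone.
- apply/trivIsetP => i j _ _ ij; rewrite /= !coneE setIACA -preimage_setI.
  by move/trivIsetP : tF => /(_ _ _ _ _ ij) ->//; rewrite preimage_set0 set0I.
- by apply: bigcupT_measurable => k; exact: measurable_cone.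
Qed.

HB.instance Definition _ := isMeasure.Build _ _ _ sphere_measure
  sphere_measure0 sphere_measure_ge0 sphere_measure_sigma_additive.

End sphere.

Section rotated_spheres.
Context (R : realType) (n p : nat).
Local Notation C := R[i].
Local Notation Cn := 'rV[C]_n.
Implicit Types (f g : Cn -> C).

(** The point [e^(j pi i / p) z] of C^n, for [z] in R^n. *)
Definition rot (j : nat) (z : n.-tuple R) : Cn :=
  let t := j%:R * pi / p%:R in
  \row_(k < n) (Complex (cos t) (sin t) * Complex (tnth z k) 0).

Definition Shat : set Cn := \bigcup_(j in `I_p) (rot j @` @sphere R n).

Definition cintegral (h : n.-tuple R -> C) : C :=
  Complex (\int[@sphere_measure R n]_(z in @sphere R n) complex.Re (h z))
          (\int[@sphere_measure R n]_(z in @sphere R n) complex.Im (h z)).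

(** Functions on [Shat] are represented by functions on C^n of which only the
    values on [Shat] matter, and elements of L^2 by Borel representatives. *)
Definition L2 f : Prop := forall j, (j < p)%N ->
  [/\ measurable_fun (@sphere R n) (fun z => complex.Re (f (rot j z))),
      measurable_fun (@sphere R n) (fun z => complex.Im (f (rot j z))) &
      (\int[@sphere_measure R n]_(z in @sphere R n)
         (complex.Re (f (rot j z)) ^+ 2 + complex.Im (f (rot j z)) ^+ 2)%:E
         < +oo)%E].

Definition inner f g : C :=
  p%:R^-1 * cintegral (fun z => \sum_(j < p) f (rot j z) * conjc (g (rot j z))).

Definition L2norm f : R := Num.sqrt (complex.Re (inner f f)).

(** Restrictions to [Shat] are extended by zero to C^n, so that two of them are
    equal as functions on C^n iff they agree on [Shat]. *)
Definition polyharmonic_Shat (m : nat) : set (Cn -> C) :=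
  [set patch (fun=> 0) Shat (polyfun u) | u in is_polyharmonic p m].

Definition is_zonal (m : nat) (eta : Cn) (Z : Cn -> C) : Prop :=
  polyharmonic_Shat m Z /\
  forall q, polyharmonic_Shat m q -> q eta = inner q Z.

(** The reproducing kernel exists and is unique for [eta] in [Shat] (Riesz); the
    default value is only used for [eta] outside of [Shat]. *)
Definition zonal (m : nat) (eta : Cn) : Cn -> C :=
  xget (fun=> 0) [set Z | is_zonal m eta Z].

End rotated_spheres.

(* Main.v *)
Require Import Defs.
From HB Require Import structures.
From mathcomp Require Import all_boot all_order all_algebra complex.
From mathcomp Require Import ring lra.
From mathcomp Require mpoly ssrcomplements.

(** Write H_m for the polyharmonic polynomials of order p and degree m. The
    function eta |-> <f, Z_m(., eta)> turns out to be the orthogonal projection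
    of f to H_m ([zonal_projection]). Since the spaces H_m are pairwise
    orthogonal ([inner_polyharmonic_orthogonal]), the partial sums of the series
    are the best approximations of f by elements of H_0 + ... + H_(N-1), and they
    converge to f because the sum of all H_m is dense ([polysum_dense]).

    Orthogonality. By the decomposition of Almansi ([almansi]) an element of H_m
    is a combination of |x|^(2k) h_k with k < p and h_k harmonic of degree
    m - 2k. As |x| = 1 on the sphere and u is homogeneous, the inner product of
    u in H_l and v in H_m is the product of the mean of w_j^l conj(w_j)^m over
    the rotations w_j = e^(j pi i / p) and of the integral of u conj(v) over the
    sphere ([inner_polyfun]). The first factor vanishes when l - m is even with
    0 < |l - m| < 2p ([sum_omega_neq]); for all other l <> m the harmonic
    components of u and v have different degrees, and the second factor
    vanishes.

    Integrals over the sphere. Instead of Green's formula, the proof compares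
    the sphere with the Gaussian weight exp(-|x|^2): in polar coordinates
    ([integral_polar]) the Gaussian integral of a homogeneous polynomial is its
    integral over the sphere times a nonzero constant that depends only on the
    degree ([gauss_sphere_moment]). For the Gaussian weight, integration by
    parts is an identity between the moments of the line ([gauss_momentS]), and
    everything else is algebra: harmonic polynomials of different degrees are
    orthogonal ([gauss_harmonic_orthogonal]), and the pairing is nondegenerate
    on homogeneous polynomials ([gauss_nondegenerate]). The latter makes the
    inner product definite on H_m, so that the zonal polyharmonic exists.

    Density. Polynomials are dense in L^2 of the sphere ([polyf_dense]): the
    bounded functions that they approximate form an algebra, stable under
    bounded pointwise limits, that contains the indicators of half-spaces. On
    the sphere every polynomial is a sum of harmonic ones, and for h harmonic
    the p functions |x|^(2l) h, l < p, restrict to the rotated spheres as h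
    times the values of p different characters of Z/p, up to a factor that does
    not depend on l; inverting this Fourier transform gives a sum of
    polyharmonics that is h on one rotated sphere and 0 on the others
    ([polysum_separate]). *)

Set Implicit Arguments.
Unset Strict Implicit.
Unset Printing Implicit Defensive.

(* The notations of multivariate polynomials clash with those of analysis. *)
Module PolyharmonicAlgebra.
Import ssrcomplements mpoly GRing.Theory Num.Theory Polyharmonic.
Local Open Scope ring_scope.

(** * Polyharmonic polynomials and their Almansi decomposition *)

Section laplacian.
Context (n : nat) (F : numFieldType).
Implicit Types u v h : {mpoly F[n]}.

Definition sqnorm : {mpoly F[n]} := \sum_(i < n) 'X_i ^+ 2.

Lemma laplacian_is_linear : linear (@laplacian n F).
Proof.
move=> c u v; rewrite /laplacian scaler_sumr -big_split /=.
by apply: eq_bigr => i _; rewrite !linearP.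
Qed.

HB.instance Definition _ := GRing.isLinear.Build F {mpoly F[n]} {mpoly F[n]} _
  (@laplacian n F) laplacian_is_linear.

Lemma iter_laplacian_is_linear p : linear (iter p (@laplacian n F)).
Proof. by elim: p => [//|p IH] c u v /=; rewrite IH linearP. Qed.

HB.instance Definition _ p :=
  GRing.isLinear.Build F {mpoly F[n]} {mpoly F[n]} _
  (iter p (@laplacian n F)) (iter_laplacian_is_linear p).

Lemma mderiv_Xi (i j : 'I_n) : ('X_j : {mpoly F[n]})^`M(i) = (i == j)%:R.
Proof.
rewrite mderivX mnm1E eq_sym; case: eqP => [->|]; last by rewrite scale0r.
rewrite scale1r -mpolyX0; congr mpolyX; apply/mnmP => k.
by rewrite mnmBE subnn mnm0E.
Qed.

Lemma mderiv_sqnorm (i : 'I_n) : sqnorm^`M(i) = 'X_i *+ 2.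
Proof.
rewrite /sqnorm raddf_sum /= (bigD1 i) //= big1 => [|j ji].
  by rewrite expr2 mderivM mderiv_Xi eqxx addr0 mul1r mulr1 -mulr2n.
by rewrite expr2 mderivM mderiv_Xi eq_sym (negbTE ji) mul0r mulr0 addr0.
Qed.

Lemma mderiv_homog d u i : u \is d.-homog -> u^`M(i) \is d.-1.-homog.
Proof.
move=> /dhomogP hu; rewrite (mpolyE u) raddf_sum big_seq; apply: rpred_sum => m mu.
rewrite /= mderivZ mderivX; apply/rpredZ.
case: (posnP (m i)) => [->|mi]; first by rewrite scale0r rpred0.
have e : mdeg m = (mdeg (m - U_(i))).+1.
  rewrite -addn1 -(mdeg1 i) -mdegD submK //.
  by apply/mnm_lepP => j; rewrite mnm1E; case: eqP => // <-.
apply/rpredZ; rewrite dhomogX -(hu _ mu); apply/eqP.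
exact: (f_equal predn (esym e)).
Qed.

Lemma laplacian_homog d u : u \is d.-homog -> laplacian u \is (d - 2).-homog.
Proof.
move=> hu; rewrite -[(d - 2)%N]/(d - (1 + 1))%N subnDA !subn1.
by apply: rpred_sum => i _; do 2! apply: mderiv_homog.
Qed.

Lemma iter_laplacian_homog p d u :
  u \is d.-homog -> iter p (@laplacian _ _) u \is (d - p.*2).-homog.
Proof.
move=> hu; elim: p => [|p IH]; first by rewrite subn0.
by rewrite doubleS -addn2 subnDA iterS; exact: laplacian_homog.
Qed.

Lemma mderiv_homog0 u i : u \is 0.-homog -> u^`M(i) = 0.
Proof.
move=> /dhomogP hu; rewrite (mpolyE u) raddf_sum big_seq big1 //= => m mu.
have /eqP := hu _ mu; rewrite mdeg_eq0 => /eqP ->.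
by rewrite mderivZ mderivX mnm0E scale0r scaler0.
Qed.

Lemma laplacian_homog_lt2 d u : (d < 2)%N -> u \is d.-homog -> laplacian u = 0.
Proof.
move=> d2 hu; rewrite /laplacian big1 // => i _; apply: mderiv_homog0.
by move: d d2 hu => [|[|//]] _ /mderiv_homog; apply.
Qed.

Lemma iter_laplacian_eq0 p d u :
  (d < p.*2)%N -> u \is d.-homog -> iter p (@laplacian _ _) u = 0.
Proof.
elim: p d u => [//|p IH] d u dp hu; rewrite iterSr.
case: (ltnP d 2) => d2; first by rewrite (laplacian_homog_lt2 d2) // linear0.
apply: (IH (d - 2)%N); last exact: laplacian_homog.
by rewrite ltn_subLR // addnC addn2 -doubleS.
Qed.

Lemma euler_homog d u : u \is d.-homog ->
  \sum_(i < n) 'X_i * u^`M(i) = u *+ d.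
Proof.
move=> /dhomogP hu; rewrite [u in RHS](mpolyE u) -sumrMnl.
have E i : 'X_i * u^`M(i) =
    \sum_(m <- msupp u) 'X_i * (u@_m *: 'X_[m])^`M(i).
  by rewrite {1}(mpolyE u) raddf_sum mulr_sumr.
under eq_bigr do rewrite E.
rewrite exchange_big /= big_seq [RHS]big_seq; apply: eq_bigr => m mu.
rewrite -(hu _ mu) [X in _ *+ X](mdegE m) -sumrMnr; apply: eq_bigr => i _.
rewrite mderivZ mderivX.
case: (posnP (m i)) => [->|mi]; first by rewrite scale0r scaler0 mulr0.
rewrite -!scalerAr -mpolyXD addmC submK.
  by rewrite scalerA mulrC -scalerA scaler_nat.
by apply/mnm_lepP => j; rewrite mnm1E; case: eqP => // <-.
Qed.

Lemma laplacianM u v : laplacian (u * v) =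
  laplacian u * v + (\sum_(i < n) u^`M(i) * v^`M(i)) *+ 2 + u * laplacian v.
Proof.
rewrite /laplacian mulr_suml mulr_sumr -sumrMnl -!big_split /=.
by apply: eq_bigr => i _; rewrite !mderivM !mderivD !mderivM; ring.
Qed.

Lemma laplacian_sqnormM d v : v \is d.-homog ->
  laplacian (sqnorm * v) = v *+ (n.*2 + d * 4) + sqnorm * laplacian v.
Proof.
move=> hv; rewrite laplacianM; congr (_ + _).
have -> : laplacian sqnorm = n.*2%:R.
  rewrite /laplacian; under eq_bigr => i _ do
    rewrite mderiv_sqnorm mderivMn mderiv_Xi eqxx.
  by rewrite sumr_const card_ord -mulrnA mul2n.
under eq_bigr => i _ do rewrite mderiv_sqnorm mulrnAl.
by rewrite sumrMnl (euler_homog hv) mulrnDr mulr_natl -!mulrnA.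
Qed.

Lemma sqnorm_homog : sqnorm \is 2.-homog.
Proof.
apply: rpred_sum => i _; rewrite mpolyXn dhomogX /= mdegMn mdeg1 //.
Qed.

Lemma sqnormX_homog j d h : h \is d.-homog -> sqnorm ^+ j * h \is (d + j.*2).-homog.
Proof.
move=> hh; rewrite addnC -mul2n; apply: dhomogM => //.
exact: dhomogMn sqnorm_homog.
Qed.

(** The factor by which the Laplacian sends |x|^(2(j+1)) h to |x|^(2j) h, for h
    harmonic of degree d, is 2 (j+1) (n + 2 d + 2 j). The recursive form is the
    one that the product rule gives; being positive, it can be divided by in
    [almansi]. *)
Fixpoint radial_const (d j : nat) : nat :=
  (n.*2 + (d + j.*2) * 4 + if j is i.+1 then radial_const d i else 0)%N.

Lemma laplacian_radial d j h : h \is d.-homog -> laplacian h = 0 ->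
  laplacian (sqnorm ^+ j.+1 * h) = (sqnorm ^+ j * h) *+ radial_const d j.
Proof.
move=> hh h0; elim: j => [|j IH].
  rewrite expr1 expr0 mul1r (laplacian_sqnormM hh) h0 mulr0 addr0 /=.
  by rewrite !addn0.
rewrite exprS -mulrA (laplacian_sqnormM (sqnormX_homog j.+1 hh)) IH.
by rewrite mulrnAr mulrA -exprS -mulrnDr.
Qed.

Lemma radial_const_gt0 d j : (0 < n)%N -> (0 < radial_const d j)%N.
Proof. by move=> n0; case: j => [|j] /=; rewrite !addn_gt0 double_gt0 n0. Qed.

Lemma iter_laplacian_radial d j h : h \is d.-homog -> laplacian h = 0 ->
  iter j (@laplacian _ _) (sqnorm ^+ j * h) =
  h *+ \prod_(i < j) radial_const d i.
Proof.
move=> hh h0; elim: j => [|j IH]; first by rewrite expr0 mul1r big_ord0.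
by rewrite iterSr (laplacian_radial j hh h0) linearMn /= IH big_ord_recr /= mulrnA.
Qed.

Lemma radial_polyharmonic p d j h : (j < p)%N ->
  h \is d.-homog -> laplacian h = 0 ->
  is_polyharmonic p (d + j.*2) (sqnorm ^+ j * h).
Proof.
move=> jp hh h0; split; first exact: sqnormX_homog.
rewrite -(subnK jp) addnS -addSn iterD (iter_laplacian_radial j hh h0).
by rewrite linearMn /= -iterS iterSr h0 linear0 mul0rn.
Qed.

(** If u has order s + 1, then laplacian^s u is harmonic and a multiple of
    |x|^(2s) laplacian^s u has the same image under laplacian^s, so that
    subtracting it lowers the order. The degree d - 2k is truncated, hence the
    separate clause for 2k > d. *)
Lemma almansi s d u : (0 < n)%N -> u \is d.-homog ->
    iter s (@laplacian _ _) u = 0 ->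
  exists h : nat -> {mpoly F[n]},
    [/\ forall k, h k \is (d - k.*2).-homog,
        forall k, laplacian (h k) = 0,
        forall k, (d < k.*2)%N -> h k = 0 &
        u = \sum_(k < s) sqnorm ^+ k * h k].
Proof.
move=> n0; elim: s u => [|s IH] u hu us.
  exists (fun=> 0); split=> [k|k|//|]; rewrite ?rpred0 ?linear0 //.
  by rewrite big_ord0.
have hh := iter_laplacian_homog s hu; rewrite /= in us.
set h := iter s _ u in us hh.
pose c := (\prod_(i < s) radial_const (d - s.*2) i)%N.
have c0 : (c%:R : F) != 0.
  rewrite pnatr_eq0 -lt0n /c; elim/big_ind: _ => //.
    by move=> a b a0 b0; rewrite muln_gt0 a0.
  by move=> i _; exact: radial_const_gt0.
pose w := c%:R^-1 *: (sqnorm ^+ s * h).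
have hs : (d < s.*2)%N -> h = 0 by move=> /iter_laplacian_eq0; apply.
have hw : w \is d.-homog.
  apply: rpredZ; case: (ltnP d s.*2) => ds; first by rewrite hs // mulr0 rpred0.
  by have := sqnormX_homog s hh; rewrite subnK.
have [|g [g1 g2 g3 g4]] := IH (u - w) (rpredB hu hw).
  rewrite linearB /= linearZ /= (iter_laplacian_radial s hh us) -/c.
  by rewrite -scaler_nat scalerA mulVf // scale1r subrr.
exists (fun k => if k == s then c%:R^-1 *: h else g k); split.
- by move=> k; case: eqP => [->|_//]; exact: rpredZ.
- by move=> k; case: eqP => // _; rewrite linearZ /= us scaler0.
- by move=> k dk; case: eqP => [ks|_]; [rewrite hs ?scaler0 // -ks | exact: g3].
rewrite big_ord_recr /= eqxx -scalerAr -/w -(addrNK w u) g4; congr (_ + _).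
by apply: eq_bigr => i _; rewrite ltn_eqF.
Qed.

Lemma polyharmonic0 p m : is_polyharmonic p m (0 : {mpoly F[n]}).
Proof. by split; [exact: rpred0|rewrite linear0]. Qed.

Lemma polyharmonicP p m a u v : is_polyharmonic p m u ->
  is_polyharmonic p m v -> is_polyharmonic p m (a *: u + v).
Proof.
move=> [hu pu] [hv pv]; split; first by rewrite rpredD ?rpredZ.
by rewrite linearP /= pu pv scaler0 addr0.
Qed.

End laplacian.

(** The span, encoded by its induction principle. *)
Definition inspan (F : pzRingType) (V : lmodType F) (s : seq V) (x : V) : Prop :=
  forall P : V -> Prop, P 0 -> (forall a u v, P u -> P v -> P (a *: u + v)) ->
    (forall u, u \in s -> P u) -> P x.

(** The polyharmonics of degree m are the kernel of a linear map between the
    finite-dimensional spaces of homogeneous polynomials. *)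
Lemma polyharmonic_span (n : nat) (F : numFieldType) p m : (0 < n)%N -> exists s,
  (forall u : {mpoly F[n]}, u \in s -> is_polyharmonic p m u) /\
  (forall u : {mpoly F[n]}, is_polyharmonic p m u -> inspan s u).
Proof.
case: n => // n _.
pose V := dhomog n.+1 F m.
pose W := dhomog n.+1 F (m - p.*2).
have hD (u : V) : iter p (@laplacian _ _) (val u) \is (m - p.*2).-homog.
  exact/iter_laplacian_homog/dhomog_is_dhomog.
pose f (u : V) : W := DHomog (hD u).
have lf : linear f by move=> a u v; apply/val_inj; rewrite /= linearP.
pose fL := GRing.isLinear.Build F V W _ f lf.
pose g : {linear V -> W} := HB.pack f fL.
pose K := lker (linfun g).
have K0 (u : V) : (u \in K) = (iter p (@laplacian _ _) (val u) == 0).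
  by rewrite memv_ker lfunE /= -(inj_eq val_inj).
exists [seq val u | u <- vbasis K]; split.
  move=> _ /mapP[u uK ->]; split; first exact: dhomog_is_dhomog.
  by apply/eqP; rewrite -K0; exact: vbasis_mem.
move=> u [hu pu] P P0 PD Ps; pose v : V := DHomog hu.
have vK : v \in K by rewrite K0 /= pu.
rewrite -[u]/(val v) (coord_vbasis vK) raddf_sum /=.
elim/big_ind: _ => // [a b Pa Pb|i _].
  by rewrite -(scale1r a); exact: PD.
rewrite -[X in P X]addr0; apply: PD => //; apply: Ps.
by apply/map_f/mem_nth; rewrite size_tuple.
Qed.


(** On a homogeneous polynomial of degree d, the power d + 1 of the Laplacian
    vanishes, so that the decomposition of Almansi covers all polynomials. *)
Lemma harmonic_ind (n : nat) (F : numFieldType) (P : {mpoly F[n]} -> Prop) :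
    (0 < n)%N -> P 0 -> (forall a u v, P u -> P v -> P (a *: u + v)) ->
    (forall d k h, h \is d.-homog -> laplacian h = 0 -> P (sqnorm n F ^+ k * h)) ->
  forall u, P u.
Proof.
move=> n0 P0 PD Ph u.
have PA u' v' : P u' -> P v' -> P (u' + v').
  by move=> Pu Pv; rewrite -[u']scale1r; exact: PD.
rewrite (pihomog_partitionE (leqnn (mmeasure mdeg u))).
elim/big_ind: _ => // d _.
have [|h [hh h0 _ ->]] := almansi (s := d.+1) n0 (pihomogP mdeg d u).
  apply: iter_laplacian_eq0 (pihomogP mdeg d u).
  by rewrite doubleS ltnS -addnn leqW // leq_addr.
elim/big_ind: _ => // k _; exact: Ph.
Qed.

(** * Gaussian and spherical functionals on polynomials *)

Section functionals.
Context (n : nat) (F : numFieldType).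
Implicit Types (u v h : {mpoly F[n]}) (c : 'X_{1..n} -> F).

(** The functional with prescribed values on the monomials. *)
Definition mfunctional c u : F := \sum_(m <- msupp u) u@_m * c m.

Lemma mfunctionalwE c k u : (msize u <= k)%N ->
  mfunctional c u = \sum_(m : 'X_{1..n < k}) u@_m * c m.
Proof.
move=> uk; pose I : subFinType _ := 'X_{1..n < k}.
rewrite /mfunctional (big_mksub I) //=; first last.
- by move=> x /msize_mdeg_lt /leq_trans /(_ uk) ->.
- by rewrite msupp_uniq.
by rewrite big_rmcond //= => i /memN_msupp_eq0 ->; rewrite mul0r.
Qed.

Lemma mfunctional_is_linear c : linear_for *%R (mfunctional c).
Proof.
move=> a u v; pose k := maxn (maxn (msize u) (msize v)) (msize (a *: u + v)).
rewrite !(@mfunctionalwE c k) ?leq_max ?leqnn ?orbT // mulr_sumr -big_split /=.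
by apply: eq_bigr => m _; rewrite mcoeffD mcoeffZ mulrDl mulrA.
Qed.

HB.instance Definition _ c := GRing.isLinear.Build F {mpoly F[n]} F _
  (mfunctional c) (mfunctional_is_linear c).

Lemma mfunctionalX c m : mfunctional c 'X_[m] = c m.
Proof. by rewrite /mfunctional msuppX big_seq1 mcoeffX eqxx mul1r. Qed.

(* M k stands for the integral of t^k exp(-t^2) over the line; [MS] is its
   integration by parts. *)
Context (M : nat -> F).
Hypothesis M0 : M 0 != 0.
Hypothesis M1 : M 1 = 0.
Hypothesis MS : forall k, M k.+2 *+ 2 = M k *+ k.+1.

Definition gauss_functional := mfunctional (fun m => \prod_(i < n) M (m i)).
Local Notation L := gauss_functional.

HB.instance Definition _ := GRing.Linear.on gauss_functional.

(** Gaussian integration by parts: the derivative of exp(-t^2) is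
    -2t exp(-t^2). *)
Lemma gauss_functionalXM i u : L ('X_i * u) *+ 2 = L u^`M(i).
Proof.
have -> : u^`M(i) = \sum_(m <- msupp u) u@_m *: 'X_[m]^`M(i).
  rewrite {1}(mpolyE u) raddf_sum; apply: eq_bigr => m _ /=.
  by rewrite mderivZ.
rewrite {1}(mpolyE u) mulr_sumr /L !linear_sum -sumrMnl.
apply: eq_bigr => m _; rewrite -scalerAr !linearZ /= -mulrnAr; congr (_ * _).
rewrite -mpolyXD mderivX linearZ /= !mfunctionalX.
rewrite (bigD1 i) //= (bigD1 i (P := xpredT)) //= -mulrnAl mulrA.
congr (_ * _); last first.
  apply: eq_bigr => j ji; congr M.
  by rewrite mnmDE mnmBE mnm1E eq_sym (negbTE ji) subn0.
rewrite mnmDE mnmBE mnm1E eqxx add1n; case: (m i) => [|k].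
  by rewrite M1 mul0rn mul0r.
by rewrite MS subn1 /= mulr_natl.
Qed.

(** The divergence of v grad u is the sum on the right; integrating it by parts
    yields 2 v (x . grad u), which is 2 d u v by Euler's identity. *)
Lemma gauss_functional_dirichlet d u v : u \is d.-homog -> laplacian u = 0 ->
  L (u * v) *+ (2 * d) = L (\sum_(i < n) u^`M(i) * v^`M(i)).
Proof.
move=> hu u0.
have -> : \sum_(i < n) u^`M(i) * v^`M(i) = \sum_(i < n) (u^`M(i) * v)^`M(i).
  under [RHS]eq_bigr do rewrite mderivM.
  by rewrite big_split /= -mulr_suml -/(laplacian u) u0 mul0r add0r.
rewrite (raddf_sum L) /=.
under [RHS]eq_bigr do rewrite -gauss_functionalXM mulrA.
by rewrite sumrMnl -(raddf_sum L) /= -mulr_suml (euler_homog hu) mulrnAl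
  [in RHS](raddfMn L) /= -mulrnA mulnC.
Qed.

(** The Dirichlet form is symmetric, so that it computes L (u v) both with the
    degree of u and with that of v. *)
Lemma gauss_harmonic_orthogonal d e u v : u \is d.-homog -> v \is e.-homog ->
  laplacian u = 0 -> laplacian v = 0 -> d != e -> L (u * v) = 0.
Proof.
move=> hu hv u0 v0 de.
have eu := gauss_functional_dirichlet v hu u0.
have ev := gauss_functional_dirichlet u hv v0.
have : L (u * v) *+ (2 * d) = L (u * v) *+ (2 * e).
  rewrite eu mulrC ev; congr L.
  by apply: eq_bigr => i _; rewrite mulrC.
rewrite -[LHS]mulr_natr -[RHS]mulr_natr => /eqP; rewrite -subr_eq0 -mulrBr mulf_eq0 subr_eq0.
by rewrite eqr_nat eqn_pmul2l // (negbTE de) orbF => /eqP.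
Qed.

(** Integration by parts puts the partial derivatives of u into the radical as
    well; they vanish by induction on the degree, and so does u by Euler's
    identity. *)
Lemma gauss_nondegenerate d u : u \is d.-homog ->
  (forall v, L (u * v) = 0) -> u = 0.
Proof.
elim: d u => [|d IH] u hu Lu.
  have uE : u = (u@_0%MM)%:MP.
    apply: msize1_polyC; rewrite msizeE; apply/bigmax_leqP_seq => m mu _.
    by move/dhomogP : hu => /(_ _ mu) /= ->.
  rewrite uE; suff -> : u@_0%MM = 0 by rewrite mpolyC0.
  have /eqP := Lu 1; rewrite uE mul_mpolyC linearZ /= -uE.
  rewrite -mpolyX0 /L mfunctionalX mulf_eq0 => /orP[/eqP //|/eqP p0].
  have /prodf_neq0 : forall i : 'I_n, true -> M (0%MM i) != 0.
    by move=> i _; rewrite mnm0E.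
  by rewrite p0 eqxx.
have du i : u^`M(i) = 0.
  apply: IH => [|v]; first exact: (mderiv_homog i hu).
  have : L (u * v)^`M(i) = 0.
    by rewrite -gauss_functionalXM mulrCA Lu mul0rn.
  by rewrite mderivM linearD /= Lu addr0.
have := euler_homog hu; under eq_bigr do rewrite du mulr0.
rewrite big1 // => /esym/eqP; rewrite -mulr_natl mulf_eq0.
move=> /orP[|/eqP //].
by rewrite -mpolyC_nat mpolyC_eq0 pnatr_eq0.
Qed.

(* s m stands for the integral of the monomial m over the sphere, C d for the
   radial factor in degree d. *)
Context (s : 'X_{1..n} -> F) (C : nat -> F).
Hypothesis C0 : forall d, C d != 0.
Hypothesis Cs : forall m : 'X_{1..n}, \prod_(i < n) M (m i) = C (mdeg m) * s m.
Local Notation S := (mfunctional s).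
Hypothesis Ssqnorm : forall u, S (sqnorm n F * u) = S u.

Lemma gauss_sphere d u : u \is d.-homog -> L u = C d * S u.
Proof.
move=> /dhomogP hu; rewrite /L /mfunctional mulr_sumr big_seq [RHS]big_seq.
by apply: eq_bigr => m mu; rewrite Cs mulrCA -(hu _ mu).
Qed.

Lemma sphere_sqnormX k u : S (sqnorm n F ^+ k * u) = S u.
Proof. by elim: k => [|k IH]; rewrite ?mul1r // exprS -mulrA Ssqnorm. Qed.

Lemma sphere_harmonic_orthogonal d e u v : u \is d.-homog -> v \is e.-homog ->
  laplacian u = 0 -> laplacian v = 0 -> d != e -> S (u * v) = 0.
Proof.
move=> hu hv u0 v0 de; have := gauss_harmonic_orthogonal hu hv u0 v0 de.
by rewrite (gauss_sphere (dhomogM hu hv)) => /eqP; rewrite mulf_eq0 (negbTE (C0 _)) => /eqP.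
Qed.

(** The factor between the two functionals depends on the degree, so that they
    are compared on the homogeneous components of v. *)
Lemma sphere_nondegenerate d u : u \is d.-homog ->
  (forall v, S (u * v) = 0) -> u = 0.
Proof.
move=> hu Su; apply: (gauss_nondegenerate hu) => v.
rewrite [v](pihomog_partitionE (leqnn (msize v))) mulr_sumr linear_sum big1 //.
move=> i _ /=; rewrite (gauss_sphere (dhomogM hu (pihomogP _ _ _))) Su.
by rewrite mulr0.
Qed.

(** Under the hypothesis on l and m, no harmonic component of u has the degree
    of a harmonic component of v. *)
Lemma sphere_polyharmonic_orthogonal p l m u v : (0 < n)%N ->
  is_polyharmonic p l u -> is_polyharmonic p m v ->
  (forall j k, (j < p)%N -> (k < p)%N -> (l + k.*2 != m + j.*2)%N) ->
  S (u * v) = 0.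
Proof.
move=> n0 [hu pu] [hv pv] lm.
have [g [g1 g2 g3 ->]] := almansi n0 hu pu.
have [h [h1 h2 h3 ->]] := almansi n0 hv pv.
rewrite mulr_suml linear_sum big1 //= => j _.
rewrite mulr_sumr linear_sum big1 //= => k _.
rewrite mulrACA -mulrA /= !sphere_sqnormX.
case: (ltnP l j.*2) => lj; first by rewrite g3 // mul0r linear0.
case: (ltnP m k.*2) => mk; first by rewrite h3 // mulr0 linear0.
apply: (sphere_harmonic_orthogonal (g1 _) (h1 _)) => //.
apply: contra (lm _ _ (ltn_ord j) (ltn_ord k)) => /eqP e.
by rewrite -(subnK lj) -(subnK mk) e addnAC.
Qed.

End functionals.

Lemma map_mpoly_polyharmonic n (F : numFieldType) (f : {rmorphism F -> F}) p m
  (u : {mpoly F[n]}) : is_polyharmonic p m u ->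
  is_polyharmonic p m (map_mpoly f u).
Proof.
have fd (v : {mpoly F[n]}) i : (map_mpoly f v)^`M(i) = map_mpoly f v^`M(i).
  apply/mpolyP => k; rewrite mcoeff_map_mpoly !mcoeff_mderiv mcoeff_map_mpoly.
  by rewrite raddfMn.
have fl (v : {mpoly F[n]}) : laplacian (map_mpoly f v) = map_mpoly f (laplacian v).
  by rewrite /laplacian raddf_sum; apply: eq_bigr => i _; rewrite !fd.
move=> [hu pu]; split.
  apply/dhomogP => k; rewrite mcoeff_msupp mcoeff_map_mpoly fmorph_eq0.
  by rewrite -mcoeff_msupp; move/dhomogP : hu; apply.
have -> : iter p (@laplacian _ _) (map_mpoly f u) =
    map_mpoly f (iter p (@laplacian _ _) u).
  by elim: p {pu} => //= p ->; rewrite fl.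
by rewrite pu raddf0.
Qed.

(** * Riesz representation on a finite span, and evaluation of polynomials *)

Section riesz.
Context (F : fieldType) (V : lmodType F) (cj : {rmorphism F -> F}).
Variable B : V -> V -> F.
Hypothesis cjK : involutive cj.
Hypothesis BP : forall a u v w, B (a *: u + v) w = a * B u w + B v w.
Hypothesis BC : forall u v, B v u = cj (B u v).
Hypothesis Bnull : forall u v, B u u = 0 -> B u v = 0.
Implicit Types (u v w : V) (s : seq V).

Let BPr a u v w : B w (a *: u + v) = cj a * B w u + B w v.
Proof. by rewrite BC BP rmorphD rmorphM -!BC. Qed.

Let BD u v w : B (u + v) w = B u w + B v w.
Proof. by rewrite -[u]scale1r BP mul1r scale1r. Qed.

Let B0r u : B u 0 = 0.
Proof. by have := BPr (-1) 0 0 u; rewrite scaler0 addr0 rmorphN1 mulN1r addNr. Qed.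

Let BBr u v w : B w (u - v) = B w u - B w v.
Proof. by rewrite addrC -scaleN1r BPr rmorphN1 mulN1r addrC. Qed.

Lemma inspanP s a u v : inspan s u -> inspan s v -> inspan s (a *: u + v).
Proof. by move=> su sv P P0 PD Ps; apply: (PD); [exact: su P P0 PD Ps|exact: sv P P0 PD Ps]. Qed.

Lemma inspan_mem s u : u \in s -> inspan s u.
Proof. by move=> us P _ _; apply. Qed.

Lemma inspan_cons s v u : inspan s u -> inspan (v :: s) u.
Proof.
by move=> su P P0 PD Ps; apply: su => // w ws; apply: Ps; rewrite inE ws orbT.
Qed.

(** Gram-Schmidt on the family, without divisions by null vectors: the pairing
    may be degenerate as long as l vanishes on its null vectors, and [Bnull]
    replaces the inequality of Cauchy-Schwarz. *)
Lemma riesz s (l : V -> F) : linear_for *%R l ->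
    (forall u, inspan s u -> B u u = 0 -> l u = 0) ->
  exists2 z, inspan s z & forall u, inspan s u -> l u = B u z.
Proof.
elim: s l => [|v s IH] l lP l0.
  have l00 : l 0 = 0.
    by have := lP (-1) 0 0; rewrite scaler0 addr0 mulN1r addNr.
  exists 0 => [P //|u su].
  apply: (su (fun u => l u = B u 0)) => [|a x y lx ly|//]; first by rewrite B0r.
  by rewrite lP BP lx ly.
have lD x y : l (x + y) = l x + l y by rewrite -[x]scale1r lP mul1r scale1r.
have [|u _ uu|z sz vz] := IH (fun u => B u v).
- by move=> a x y; exact: BP.
- exact: Bnull.
(* the part of v orthogonal to the span of s, z being the projection of v *)
pose w := v - z.
have ws u : inspan s u -> B u w = 0 by move=> su; rewrite BBr vz // subrr.
have sw : inspan (v :: s) w.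
  rewrite /w addrC -scaleN1r; apply: inspanP; first exact: inspan_cons.
  by apply: inspan_mem; rewrite mem_head.
have wz u : inspan s u -> B w u = 0 by move=> su; rewrite BC ws // rmorph0.
have [Z sZ lZ] := IH l lP (fun u su => l0 u (inspan_cons su)).
have [ww|ww] := eqVneq (B w w) 0.
  exists Z; first exact: inspan_cons.
  move=> u su; apply: (su (fun u => l u = B u Z)) => [|a x y lx ly|x].
  - by rewrite -[in LHS](subrr v) addrC -scaleN1r lP BC B0r rmorph0 mulN1r addNr.
  - by rewrite lP BP lx ly.
  rewrite inE => /orP[/eqP ->|xs]; last by apply: lZ; exact: inspan_mem.
  by rewrite -(subrK z v) -/w lD BD (lZ z sz) l0 // wz // add0r.
pose c := cj (l w / B w w).
exists (c *: w + Z).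
  by apply: inspanP => //; exact: inspan_cons.
move=> u su.
apply: (su (fun u => l u = B u (c *: w + Z))) => [|a x y lx ly|x].
- by rewrite -[in LHS](subrr v) addrC -scaleN1r lP BC B0r rmorph0 mulN1r addNr.
- by rewrite lP BP lx ly.
rewrite inE => /orP[/eqP ->|xs]; last first.
  have sx := inspan_mem xs.
  by rewrite BPr (ws x sx) mulr0 add0r lZ.
rewrite -(subrK z v) -/w lD BD !BPr (wz Z sZ) (ws z sz) mulr0 addr0 add0r (lZ z sz).
by rewrite /c cjK divfK.
Qed.
End riesz.

Section evaluation.
Context (n : nat) (F : numFieldType).
Implicit Types (u v : {mpoly F[n]}) (z : 'rV[F]_n).

Lemma polyfunE u z : polyfun u z =
  \sum_(m <- msupp u) u@_m * \prod_(i < n) z 0 i ^+ m i.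
Proof. exact: mevalE. Qed.

Lemma polyfunP a u v z : polyfun (a *: u + v) z = a * polyfun u z + polyfun v z.
Proof. by rewrite /polyfun mevalD mevalZ. Qed.

Lemma polyfun_sum (I : Type) (r : seq I) (P : pred I) (f : I -> {mpoly F[n]}) z :
  polyfun (\sum_(i <- r | P i) f i) z = \sum_(i <- r | P i) polyfun (f i) z.
Proof. exact: raddf_sum. Qed.

Lemma polyfunM u v z : polyfun (u * v) z = polyfun u z * polyfun v z.
Proof. exact: mevalM. Qed.

Lemma polyfunC c z : polyfun c%:MP z = c.
Proof. exact: mevalC. Qed.

Lemma polyfunX i z : polyfun 'X_i z = z 0 i.
Proof. exact: mevalXU. Qed.

Lemma polyfun_sqnorm z : polyfun (sqnorm n F) z = \sum_(i < n) z 0 i ^+ 2.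
Proof.
rewrite /polyfun raddf_sum; apply: eq_bigr => i _ /=.
by rewrite expr2 mevalM mevalXU -expr2.
Qed.

Lemma polyfun_homogZ d u a z : u \is d.-homog ->
  polyfun u (a *: z) = a ^+ d * polyfun u z.
Proof.
move=> /dhomogP hu; rewrite !polyfunE mulr_sumr big_seq [RHS]big_seq.
apply: eq_bigr => m mu; rewrite mulrCA; congr (_ * _).
rewrite -(hu _ mu) [X in _ ^+ X](mdegE m) -prodrXr -big_split /=.
by apply: eq_bigr => i _; rewrite mxE exprMn.
Qed.

Lemma polyfun_map (f : {rmorphism F -> F}) u z :
  polyfun (map_mpoly f u) (map_mx f z) = f (polyfun u z).
Proof.
have -> : polyfun u z = \sum_(m <- msupp u) u@_m * \prod_(i < n) z 0 i ^+ m i.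
  exact: polyfunE.
rewrite rmorph_sum /= [u in LHS]mpolyE raddf_sum /polyfun raddf_sum.
apply: eq_bigr => m _ /=; rewrite map_mpolyZ map_mpolyX mevalZ mevalX rmorphM.
congr (_ * _); rewrite rmorph_prod; apply: eq_bigr => i _.
by rewrite mxE rmorphXn.
Qed.

End evaluation.

End PolyharmonicAlgebra.

From mathcomp Require Import all_classical all_reals all_analysis.
From mathcomp Require Import measurable_realfun.

Import Order.TTheory GRing.Theory Num.Theory.
Import numFieldNormedType.Exports.
Import (canonicals, coercions) mpoly.
Import Polyharmonic PolyharmonicAlgebra.
Local Open Scope classical_set_scope.
Local Open Scope ring_scope.

(** * Gaussian moments on the line *)

Section gauss_moments.
Context (R : realType).
Local Notation mu := (@lebesgue_measure R).
Implicit Types (t : R) (k : nat).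

Definition gaussX k t : R := t ^+ k * gauss_fun t.

Lemma continuous_gaussX k : continuous (gaussX k).
Proof.
move=> t; apply: cvgM; last exact: continuous_gauss_fun.
exact: exprn_continuous.
Qed.

Lemma measurable_gaussX k : measurable_fun setT (gaussX k).
Proof. by apply: continuous_measurable_fun; exact: continuous_gaussX. Qed.

(** A constant c with |t|^k exp(-t^2/2) <= c, obtained by keeping the term of
    order k + 1 of the exponential series of t^2/2; hence t^k exp(-t^2) is
    dominated by a multiple of a normal density. *)
Definition gaussX_const k : R := 2 ^+ k.+1 * k.+1`!%:R.

Lemma gaussX_bound k t : `|gaussX k t| <= gaussX_const k * normal_fun 0 1 t.
Proof.
rewrite /gaussX normrM (ger0_norm (gauss_fun_ge0 _)) normrX.
have -> : gauss_fun t = normal_fun 0 1 t * normal_fun 0 1 t.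
  rewrite /gauss_fun /normal_fun -expRD subr0 expr1n; congr expR.
  by field.
rewrite mulrA ler_wpM2r ?normal_fun_ge0 //.
rewrite /normal_fun subr0 expr1n -ler_pdivlMr ?expR_gt0 // -expRN.
rewrite mulNr opprK.
set y := t ^+ 2 / _.
have y0 : 0 <= y by rewrite divr_ge0 ?sqr_ge0.
apply: (@le_trans _ _ (gaussX_const k * (1 + y ^+ k.+1 / k.+1`!%:R))); last first.
  by rewrite ler_wpM2l ?expR_ge1Dxn // mulr_ge0 // exprn_ge0.
have -> : gaussX_const k * (1 + y ^+ k.+1 / k.+1`!%:R) =
    gaussX_const k + (`|t| ^+ 2) ^+ k.+1.
  rewrite mulrDr mulr1; congr (_ + _).
  rewrite mulrCA /gaussX_const -mulrA mulfV ?mulr1; last first.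
    by rewrite pnatr_eq0 -lt0n fact_gt0.
  by rewrite -exprMn real_normK ?num_real // /y divfK // pnatr_eq0.
case: (leP `|t| 1) => t1.
  apply: (@le_trans _ _ 1); first by rewrite exprn_ile1.
  apply: (@le_trans _ _ (gaussX_const k)); last by rewrite lerDl exprn_ge0 // exprn_ge0.
  rewrite /gaussX_const -natrX -natrM ler1n muln_gt0 fact_gt0 expn_gt0 //.
apply: (@le_trans _ _ ((`|t| ^+ 2) ^+ k.+1)); last first.
  by rewrite lerDr mulr_ge0 // exprn_ge0.
by rewrite -exprM ler_weXn2l ?ltW // mul2n -addnn (leq_trans (leqnSn k)) // leq_addr.
Qed.

Lemma integrable_gaussX k : mu.-integrable setT (EFin \o gaussX k).
Proof.
have : mu.-integrable setT
    (fun t => (gaussX_const k / normal_peak 1)%:E * (normal_pdf 0 1 t)%:E)%E.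
  apply: integrableZl => //; exact: integrable_normal_pdf.
apply: le_integrable => //=.
  apply/measurable_EFinP; exact: measurable_gaussX.
move=> t _; rewrite lee_fin (le_trans (gaussX_bound k t)) //.
rewrite (_ : gaussX_const k * _ = gaussX_const k / normal_peak 1 * normal_pdf 0 1 t).
  exact: ler_norm.
rewrite normal_pdfE ?oner_eq0//= -mulrA.
by rewrite mulKf // gt_eqF // normal_peak_gt0 // oner_eq0.
Qed.

Definition gauss_moment k : R := \int[mu]_t gaussX k t.

Lemma gauss_moment0_gt0 : 0 < gauss_moment 0.
Proof.
rewrite /gauss_moment /Rintegral.
under eq_integral do rewrite /gaussX expr0 mul1r.
by rewrite integralT_gauss /= sqrtr_gt0 pi_gt0.
Qed.

Lemma gaussX_derive k t : is_derive t 1 (gaussX k)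
  (k%:R * gaussX k.-1 t - 2 * gaussX k.+1 t).
Proof.
have d1 : is_derive t 1 ((@id R) ^+ k : R -> R) ((k%:R * t ^+ k.-1) *: 1).
  exact: is_deriveX.
have d2 : is_derive t 1 (@gauss_fun R) (- (t *+ 2) * gauss_fun t).
  have : is_derive (- t ^+ 2) 1 (@expR R) (gauss_fun t) by exact: is_derive_expR.
  have : is_derive t 1 (- ((@id R) ^+ 2) : R -> R) (- ((2%:R * t ^+ 1) *: 1)).
    exact: is_deriveN.
  move=> h1 h2.
  have := @is_derive1_comp R (@expR R) (- ((@id R) ^+ 2)) t _ _ h2 h1.
  by rewrite scaler1 expr1 mulr_natl mulrC.
have := is_deriveM d1 d2.
rewrite (_ : (_ * _) = gaussX k); last first.
  by apply/funext => x; rewrite /gaussX /= exprfctE.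
move=> h; apply: (is_derive_eq h); rewrite exprfctE /gaussX !scaler1 exprS.
by rewrite /GRing.scale /=; ring.
Qed.

(** The integral over the line of the derivative of t^k exp(-t^2), as the limit
    of the integrals over [-N, N], is zero. For k = 0 the factor k absorbs the
    truncation of k.-1. *)
Lemma gauss_momentS k : 2 * gauss_moment k.+1 = k%:R * gauss_moment k.-1.
Proof.
pose f t : R := k%:R * gaussX k.-1 t - 2 * gaussX k.+1 t.
have mf : measurable_fun setT f.
  by apply: measurable_funB; apply: measurable_funM => //; exact: measurable_gaussX.
have cf : continuous f.
  move=> t; apply: cvgB; apply: cvgM; try exact: cvg_cst; exact: continuous_gaussX.
have ZX (c : R) i : mu.-integrable setT (EFin \o (fun t => c * gaussX i t)).
  exact: (integrableZl measurableT c (integrable_gaussX i)).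
have intf : mu.-integrable setT (EFin \o f).
  exact: (integrableB measurableT (ZX k%:R k.-1) (ZX 2 k.+1)).
suff : \int[mu]_t f t = 0.
  rewrite /f RintegralB // !RintegralZl //; try exact: integrable_gaussX.
  by move/eqP; rewrite subr_eq0 => /eqP.
pose I N := `[- N.+1%:R, N.+1%:R : R]%classic.
have FTC N : (\int[mu]_(t in I N) (f t)%:E =
    (gaussX k N.+1%:R)%:E - (gaussX k (- N.+1%:R))%:E)%E.
  apply: continuous_FTC2.
  - by rewrite gtrN ?ltr0n.
  - exact/continuous_subspaceT.
  - split => [x _||]; first by have := gaussX_derive k x; case.
      apply: cvg_at_right_filter; exact: continuous_gaussX.
    apply: cvg_at_left_filter; exact: continuous_gaussX.
  - move=> x _; rewrite derive1E; have := gaussX_derive k x.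
    by move=> [_ ->].
have cv : (\int[mu]_(t in I N) (f t)%:E)%E @[N --> \oo] --> (\int[mu]_t (f t)%:E)%E.
  rewrite (_ : (fun N => _) =
      (fun N => \int[mu]_t ((fun t => (f t)%:E) \_ (I N)) t)%E); last first.
    by apply/funext => N; rewrite [LHS]integral_mkcond.
  apply: (@dominated_cvg _ _ _ mu setT measurableT _ _ (fun t => `|(f t)%:E|)%E).
  - move=> N; have mI : measurable (I N) by exact: measurable_itv.
    apply: (measurable_restrictT (EFin \o f) mI).1.
    by apply/measurable_EFinP; exact: measurable_funTS.
  - move=> t _; apply: cvg_near_cst.
    near=> N; rewrite /restrict mem_set // /I /= in_itv /= -ler_norml.
    apply: (@le_trans _ _ N%:R); last by rewrite ler_nat.
    by apply: ltW; near: N; exact: nbhs_infty_gtr.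
  - by move=> t _.
  - exact: integrable_abse.
  - by move=> N t _; rewrite /restrict; case: ifP => // _; rewrite abse0.
have cvk (e : bool) : gaussX k ((-1) ^+ e * N.+1%:R) @[N --> \oo] --> (0 : R).
  apply: norm_cvg0.
  apply: (@squeeze_cvgr _ _ _ _ (fun=> 0) (fun N => gaussX_const k.+1 * (N.+1%:R)^-1)).
  - near=> N; rewrite normr_ge0 /= ler_pdivlMr ?ltr0n //.
    have : `|gaussX k.+1 ((-1) ^+ e * N.+1%:R)| <= gaussX_const k.+1.
      apply: (le_trans (gaussX_bound _ _)).
      rewrite ler_piMr //; first by rewrite mulr_ge0 // exprn_ge0.
      by rewrite -expR0 ler_expR mulNr oppr_le0 divr_ge0 ?sqr_ge0.
    apply: le_trans; rewrite /gaussX exprSr !normrM.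
    by rewrite normr_sign mul1r (ger0_norm (ler0n _ _)) mulrAC.
  - exact: cvg_cst.
  - rewrite -(mulr0 (gaussX_const k.+1)); apply: cvgM; first exact: cvg_cst.
    exact: cvg_harmonic.
have cv0 : (\int[mu]_(t in I N) (f t)%:E)%E @[N --> \oo] --> 0%E.
  under eq_fun do rewrite FTC.
  rewrite (_ : 0%E = (0 - 0)%:E); last by rewrite subr0.
  apply: cvg_EFin; first exact: nearW.
  apply: cvgB.
    by have := cvk false; under eq_fun do rewrite mul1r.
  by have := cvk true; under eq_fun do rewrite mulN1r.
by rewrite /Rintegral (cvg_unique _ cv cv0).
Unshelve. all: by end_near. Qed.

End gauss_moments.

(** * Lebesgue measure on tuples: products and dilations *)

Section lebesgue_tuple.
Context (R : realType).
Local Notation mu := (@lebesgue_measure R).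
Local Notation vol := (lebesgue_tuple R).

Lemma measurable_tcons n : measurable_fun setT (@tcons R n).
Proof. exact: measurable_cons. Qed.

Lemma ge0_integral_tcons n (F : n.+1.-tuple R -> \bar R) :
  measurable_fun setT F -> (forall x, 0 <= F x)%E ->
  (\int[vol n.+1]_x F x = \int[mu]_t \int[vol n]_x F (tcons (t, x)))%E.
Proof.
move=> mF F0.
transitivity (\int[pushforward (mu \x vol n)%E (@tcons R n)]_x F x)%E; first by [].
rewrite ge0_integral_pushforward //; last exact: measurable_tcons.
rewrite preimage_setT fubini_tonelli1 //; last by move=> x; exact: F0.
by apply: measurableT_comp => //; exact: measurable_tcons.
Qed.

Lemma integral_tcons n (F : n.+1.-tuple R -> \bar R) :
  measurable_fun setT F -> (mu \x vol n)%E.-integrable setT (F \o @tcons R n) ->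
  (vol n.+1).-integrable setT F /\
  (\int[vol n.+1]_x F x = \int[mu]_t \int[vol n]_x F (tcons (t, x)))%E.
Proof.
move=> mF iF; split.
  exact: (integrable_pushforward (@measurable_tcons n) mF).
transitivity (\int[pushforward (mu \x vol n)%E (@tcons R n)]_x F x)%E; first by [].
rewrite (integral_pushforward (@measurable_tcons n) mF) //.
by rewrite preimage_setT -integral12_prod_meas1.
Qed.

Lemma integral_tuple_prod n (g : 'I_n -> R -> R) :
    (forall i, mu.-integrable setT (EFin \o g i)) ->
  (vol n).-integrable setT (fun x => (\prod_(i < n) g i (tnth x i))%:E) /\
  (\int[vol n]_x (\prod_(i < n) g i (tnth x i))%:E =
    (\prod_(i < n) \int[mu]_t g i t)%:E)%E.
Proof.
elim: n g => [|n IH] g ig.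
  have e : (fun x : 0.-tuple R => (\prod_(i < 0) g i (tnth x i))%:E) = cst 1%E.
    by apply/funext => x; rewrite big_ord0.
  rewrite e big_ord0 integral_cst //= diracT mul1e; split => //.
  by apply: finite_measure_integrable_cst.
have [iG eG] := IH (fun i => g (lift ord0 i)) (fun i => ig (lift ord0 i)).
set G := fun x : n.-tuple R => _ in iG eG.
have mF : measurable_fun setT (fun x : n.+1.-tuple R => (\prod_(i < n.+1) g i (tnth x i))%:E).
  apply/measurable_EFinP; apply: measurable_prod => i _.
  apply: measurableT_comp; last exact: measurable_tnth.
  by apply/measurable_EFinP; exact: measurable_int (ig i).
have E (t : R) (x : n.-tuple R) :
    (\prod_(i < n.+1) g i (tnth (tcons (t, x)) i))%:E = ((g ord0 t)%:E * G x)%E.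
  rewrite big_ord_recl -EFinM; congr (_ * _)%:E.
  by apply: eq_bigr => i _; rewrite tnthS.
have [|iF ->] := integral_tcons mF.
  apply/integrable12ltyP.
    by apply: measurableT_comp => //; exact: measurable_tcons.
  rewrite [X in (X < _)%E](_ : _ =
      (\int[mu]_t \int[vol n]_x (`|(g ord0 t)%:E| * `|G x|))%E); last first.
    apply: eq_integral => t _; apply: eq_integral => x _.
    by rewrite -abseM -E.
  have iaG : (vol n).-integrable setT (abse \o G) by exact: integrable_abse.
  under eq_integral => t _ do rewrite (integralZl measurableT iaG).
  have fG : (\int[vol n]_x (abse \o G) x)%E \is a fin_num by exact: integrable_fin_num.
  rewrite -(fineK fG) integralZr //; last exact: integrable_abse (ig ord0).
  apply: lte_mul_pinfty => //.
  - exact: integral_ge0.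
  - exact: integrable_fin_num (integrable_abse (ig ord0)).
  - by rewrite ltry.
split => //.
under eq_integral => t _ do under eq_integral => x _ do rewrite E.
under eq_integral => t _ do rewrite integralZl // eG.
rewrite (integralZr measurableT (ig ord0)) [in RHS]big_ord_recl EFinM; congr (_ * _)%E.
by rewrite /Rintegral (fineK (integrable_fin_num measurableT (ig ord0))).
Qed.

(** Both sides are measures that agree on intervals. *)
Lemma lebesgue_measure_scale (r : R) (A : set R) : 0 < r -> measurable A ->
  (r%:E * mu ((fun t => (r * t)%R : measurableTypeR R) @^-1` A))%E = mu A.
Proof.
move=> r0 mA.
have mr : measurable_fun setT (fun t : measurableTypeR R => (r * t)%R : measurableTypeR R).
  by apply: measurable_funM.
pose nu := mscale (NngNum (ltW r0))
  (measure_function_pushforward__canonical__measure_function_Measure mu mr).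
rewrite -[LHS]/(nu A); apply/esym; apply: lebesgue_measure_unique => //= _ [[a b]] _ <-.
rewrite /nu /mscale /= /pushforward.
rewrite (_ : _ @^-1` _ = `]a / r, b / r]%classic); last first.
  apply/seteqP; split => t /=; rewrite !in_itv /= ltr_pdivrMr // ler_pdivlMr //;
    by rewrite mulrC.
rewrite !lebesgue_measure_itv /= !lte_fin ltr_pM2r ?invr_gt0 //.
case: ifP => _; last by rewrite mule0.
by rewrite -!EFinD -EFinM -mulrBl mulrC divfK // gt_eqF.
Qed.

Lemma ge0_integral_scale (r : R) (f : R -> \bar R) : 0 < r ->
  measurable_fun setT f -> (forall x, 0 <= f x)%E ->
  (r%:E * \int[mu]_t f (r * t)%R = \int[mu]_t f t)%E.
Proof.
move=> r0 mf f0.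
have mr : measurable_fun setT (fun t : measurableTypeR R => (r * t)%R : measurableTypeR R).
  by apply: measurable_funM.
pose nu := (measure_function_pushforward__canonical__measure_function_Measure mu mr).
transitivity (r%:E * \int[nu]_t f t)%E.
  by rewrite /nu ge0_integral_pushforward.
rewrite -(ge0_integral_mscale nu measurableT (NngNum (ltW r0))) //.
by apply: eq_measure_integral => A mA _; exact: (lebesgue_measure_scale r0 mA).
Qed.

Lemma tscale_tcons n (r t : R) (x : n.-tuple R) :
  tscale r (tcons (t, x)) = tcons ((r * t)%R, tscale r x).
Proof.
apply: eq_from_tnth => i; rewrite tnth_mktuple.
by case: (unliftP ord0 i) => [j|] ->; rewrite ?tnth0 ?tnthS ?tnth_mktuple.
Qed.

Lemma measurable_tscale n (r : R) : measurable_fun setT (@tscale R n r).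
Proof.
apply/measurable_fun_tnthP => i.
rewrite (_ : _ \o _ = fun x => r * tnth x i).
  by apply: measurable_funM => //; exact: measurable_tnth.
by apply/funext => x /=; rewrite tnth_mktuple.
Qed.

Lemma ge0_integral_tscale n (r : R) (F : n.-tuple R -> \bar R) : 0 < r ->
  measurable_fun setT F -> (forall x, 0 <= F x)%E ->
  ((r ^+ n)%:E * \int[vol n]_x F (tscale r x) = \int[vol n]_x F x)%E.
Proof.
move=> r0; elim: n F => [|n IH] F mF F0.
  rewrite mul1e; apply: eq_integral => x _; congr F.
  by rewrite (tuple0 x) (tuple0 (tscale _ _)).
have mFs : measurable_fun setT (fun x => F (tscale r x)).
  by apply: measurableT_comp => //; exact: measurable_tscale.
have mFt t : measurable_fun setT (fun x => F (tcons (t, x))).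
  apply: measurableT_comp => //.
  exact: (measurableT_comp (@measurable_tcons n) (measurable_pair1 t)).
rewrite !ge0_integral_tcons //.
under eq_integral => t _ do under eq_integral => x _ do rewrite tscale_tcons.
have E t : ((r ^+ n)%:E * \int[vol n]_x F (tcons ((r * t)%R, tscale r x)) =
    \int[vol n]_x F (tcons ((r * t)%R, x)))%E.
  by rewrite (IH (fun x => F (tcons ((r * t)%R, x)))).
pose G t := (\int[vol n]_x F (tcons (t, x)))%E.
have mG : measurable_fun setT G.
  apply: (measurable_fun_fubini_tonelli_F (F \o @tcons R n)) => //.
    by apply: measurableT_comp => //; exact: measurable_tcons.
  by move=> x; exact: F0.
have G0 t : (0 <= G t)%E by exact: integral_ge0.
rewrite -[RHS](ge0_integral_scale r0 mG G0) exprS EFinM -muleA; congr (_ * _)%E.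
rewrite -ge0_integralZl //.
- by apply: eq_integral => t _; rewrite E.
- apply: (measurable_fun_fubini_tonelli_F
    (fun z : measurableTypeR R * n.-tuple R => F (tcons ((r * z.1)%R, tscale r z.2)))) => //.
  rewrite (_ : (fun _ => _) = (fun x => F (tscale r x)) \o @tcons R n).
    by apply: measurableT_comp => //; exact: measurable_tcons.
  by apply/funext => -[t x] /=; rewrite tscale_tcons.
- by move=> t _; exact: integral_ge0.
- by rewrite lee_fin exprn_ge0 // ltW.
Qed.

Lemma vol_tscale n (r : R) (A : set (n.-tuple R)) : 0 < r -> measurable A ->
  ((r ^+ n)%:E * vol n (tscale r @^-1` A) = vol n A)%E.
Proof.
move=> r0 mA.
have mA' : measurable (tscale r @^-1` A).
  by rewrite -[X in measurable X]setTI; exact: measurable_tscale.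
have e B : measurable B -> vol n B = (\int[vol n]_x (\1_B x)%:E)%E.
  by move=> mB; rewrite integral_indic // setIT.
rewrite !e // -[RHS](ge0_integral_tscale r0) //.
by apply/measurable_EFinP; exact: measurable_indic.
Qed.

End lebesgue_tuple.

(** * Norm, normalisation and cones *)

Section norm.
Context (R : realType) (n : nat).
Local Notation mu := (@lebesgue_measure R).
Local Notation vol := (lebesgue_tuple R n).
Local Notation sigma := (@sphere_measure R n).
Local Notation norm2 := (@norm2 R n).
Implicit Types (x : n.-tuple R) (A : set (n.-tuple R)).

Definition normalise x : n.-tuple R := tscale (norm2 x)^-1 x.

Lemma norm2_ge0 x : 0 <= norm2 x.
Proof. exact: sqrtr_ge0. Qed.

Lemma sqr_norm2 x : norm2 x ^+ 2 = \sum_(i < n) tnth x i ^+ 2.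
Proof. by rewrite sqr_sqrtr // sumr_ge0 // => i _; exact: sqr_ge0. Qed.

Lemma norm2_tscale r x : 0 <= r -> norm2 (tscale r x) = r * norm2 x.
Proof.
move=> r0; apply/eqP; rewrite -(eqrXn2 (n := 2)) ?mulr_ge0 ?norm2_ge0 //.
rewrite exprMn !sqr_norm2 mulr_sumr; apply/eqP; apply: eq_bigr => i _.
by rewrite tnth_mktuple exprMn.
Qed.

Lemma tscaleA r s x : tscale r (tscale s x) = tscale (r * s) x.
Proof. by apply: eq_from_tnth => i; rewrite !tnth_mktuple mulrA. Qed.

Lemma tscale1 x : tscale 1 x = x.
Proof. by apply: eq_from_tnth => i; rewrite tnth_mktuple mul1r. Qed.

Lemma norm2_eq0 x : norm2 x = 0 -> x = tscale 0 x.
Proof.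
move=> x0; have := sqr_norm2 x; rewrite x0 expr0n /= => /esym/eqP.
rewrite psumr_eq0 => [/allP h|i _]; last exact: sqr_ge0.
apply: eq_from_tnth => i; rewrite tnth_mktuple mul0r.
by have := h i (mem_index_enum i); rewrite sqrf_eq0 => /eqP.
Qed.

Lemma normaliseK x : tscale (norm2 x) (normalise x) = x.
Proof.
rewrite /normalise tscaleA; have [x0|x0] := eqVneq (norm2 x) 0.
  by rewrite x0 mul0r -norm2_eq0.
by rewrite mulfV // tscale1.
Qed.

Lemma normalise_tscale r x : 0 < r -> normalise (tscale r x) = normalise x.
Proof.
move=> r0; rewrite /normalise norm2_tscale ?ltW // tscaleA.
by rewrite invfM mulrAC mulVf ?mul1r ?gt_eqF.
Qed.

Lemma measurable_norm2 : measurable_fun setT norm2.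
Proof.
apply: (@measurableT_comp _ _ _ _ _ _ (@Num.sqrt R)).
  by apply: continuous_measurable_fun => z; exact: sqrt_continuous.
by apply: measurable_sum => i; apply: measurable_funX; exact: measurable_tnth.
Qed.

Lemma measurable_normalise : measurable_fun setT normalise.
Proof.
apply/measurable_fun_tnthP => i.
rewrite (_ : _ \o _ = fun x => norm2 x `^ (-1) * tnth x i).
  apply: measurable_funM; last exact: measurable_tnth.
  exact: (measurableT_comp (measurable_powR _) measurable_norm2).
apply/funext => x; rewrite /= tnth_mktuple powR_inv1 //; exact: norm2_ge0.
Qed.

Lemma measurable_sphere : measurable (@sphere R n).
Proof.
rewrite (_ : @sphere R n = norm2 @^-1` [set 1]) //.
by rewrite -[X in measurable X]setTI; exact: measurable_norm2.
Qed.

Lemma coneE A : cone A = normalise @^-1` A `&` (norm2 @^-1` `]0, 1]).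
Proof.
apply/seteqP; split => x /=.
  move=> [r [z [/andP[r0 r1] Sz Az ->]]]; rewrite in_itv /=.
  have z1 : norm2 z = 1 by [].
  rewrite normalise_tscale // (norm2_tscale _ (ltW r0)) z1 mulr1; split.
    by rewrite /normalise z1 invr1 tscale1.
  by apply/andP.
rewrite in_itv /= => -[Ax /andP[x0 x1]].
exists (norm2 x), (normalise x); split => //; rewrite ?x0 ?normaliseK //.
by rewrite /sphere /= norm2_tscale ?invr_ge0 ?ltW // mulVf // gt_eqF.
Qed.

Lemma measurable_cone A : measurable A -> measurable (cone A).
Proof.
move=> mA; rewrite coneE; apply: measurableI; rewrite -[X in measurable X]setTI.
  exact: measurable_normalise.
exact: measurable_norm2.
Qed.

Lemma prod_gaussX (a : 'I_n -> nat) x :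
  \prod_(i < n) gaussX (a i) (tnth x i) =
  (\prod_(i < n) tnth x i ^+ a i) * gauss_fun (norm2 x).
Proof.
rewrite big_split /=; congr (_ * _).
by rewrite /gauss_fun -expR_sum sumrN sqr_norm2.
Qed.

Lemma integral_gauss_monomial (a : 'I_n -> nat) :
  vol.-integrable setT (fun x => ((\prod_(i < n) tnth x i ^+ a i) *
    gauss_fun (norm2 x))%:E) /\
  (\int[vol]_x ((\prod_(i < n) tnth x i ^+ a i) * gauss_fun (norm2 x))%:E =
  (\prod_(i < n) gauss_moment R (a i))%:E)%E.
Proof.
have := integral_tuple_prod (fun i => @integrable_gaussX R (a i)).
by under eq_fun do rewrite prod_gaussX.
Qed.

Lemma gauss_volume : vol.-integrable setT (fun x => (gauss_fun (norm2 x))%:E) /\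
  (0 < \int[vol]_x (gauss_fun (norm2 x))%:E)%E.
Proof.
have [] := integral_gauss_monomial (fun=> 0).
under eq_fun do rewrite (eq_bigr (fun=> 1)) // big1 // mul1r.
move=> h ->; split => //; rewrite lte_fin; apply: prodr_gt0 => i _.
exact: gauss_moment0_gt0.
Qed.

Lemma measurable_unit_ball : measurable (@unit_ball R n).
Proof.
rewrite (_ : @unit_ball R n = norm2 @^-1` `]-oo, 1]) //.
by rewrite -[X in measurable X]setTI; exact: measurable_norm2.
Qed.

(** The integral of the Gaussian is finite, and exp(-|x|^2) >= 1/e on the
    ball. *)
Lemma vol_unit_ball_lty : (vol (@unit_ball R n) < +oo)%E.
Proof.
have [ig _] := gauss_volume; have mB := measurable_unit_ball.
have : vol.-integrable setT (fun x => (expR 1)%:E * (gauss_fun (norm2 x))%:E)%E.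
  exact: integrableZl.
move/integrableP => [mg]; apply: le_lt_trans.
rewrite -[@unit_ball R n]setIT -integral_indic //; apply: ge0_le_integral => //.
- by apply/measurable_EFinP; exact: measurable_indic.
- by apply: measurableT_comp.
- move=> x _; rewrite lee_fin indicE; case: (boolP (x \in _)) => [|_].
    rewrite inE /unit_ball /= => x1; rewrite -expRD; apply: le_trans (ler_norm _).
    rewrite -[leLHS]expR0 ler_expR subr_ge0.
    by rewrite exprn_ile1 // norm2_ge0.
  exact: normr_ge0.
Qed.

End norm.

(** * Polar coordinates *)

Section polar_integration.
Context (R : realType) (n : nat).
Local Notation vol := (lebesgue_tuple R n).
Local Notation sigma := (@sphere_measure R n).
Local Notation ball := (@unit_ball R n).

Lemma cone_sub_unit_ball (A : set (n.-tuple R)) : cone A `<=` ball.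
Proof. by rewrite coneE => x [_] /=; rewrite in_itv /= => /andP[]. Qed.

Lemma vol_cone_lty A : measurable A -> (vol (cone A) < +oo)%E.
Proof.
move=> mA; apply: le_lt_trans (vol_unit_ball_lty R n).
apply: le_measure; rewrite ?inE; last exact: cone_sub_unit_ball.
  exact: measurable_cone.
exact: measurable_unit_ball.
Qed.

Lemma sphere_measure_fin_num : fin_num_fun sigma.
Proof.
move=> A mA; rewrite /sphere_measure fin_numM // ge0_fin_numE //.
exact: vol_cone_lty.
Qed.

HB.instance Definition _ := Measure_isFinite.Build _ _ _ sigma
  sphere_measure_fin_num.

Lemma sphere_measureC : sigma (~` @sphere R n) = 0%E.
Proof.
rewrite /sphere_measure (_ : cone _ = set0) ?measure0 ?mule0 //.
by apply/seteqP; split => // x [r [z []]].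
Qed.

Lemma vol_dilation r A : 0 < r -> measurable A ->
  vol (@norm2 R n @^-1` `]-oo, r] `&` @normalise R n @^-1` A) =
  ((r ^+ n)%:E * vol (@norm2 R n @^-1` `]-oo, 1%R] `&` @normalise R n @^-1` A))%E.
Proof.
move=> r0 mA; set B := (X in vol X = _); set B1 := (X in (_ * vol X)%E).
have mB : measurable B.
  apply: measurableI; rewrite -[X in measurable X]setTI.
    exact: measurable_norm2.
  exact: measurable_normalise.
rewrite -(vol_tscale r0 mB) (_ : _ @^-1` B = B1) //.
apply/seteqP; split => x; rewrite /B /B1 /= !in_itv /= normalise_tscale //.
  by rewrite (norm2_tscale _ (ltW r0)) ger_pMr.
by rewrite (norm2_tscale _ (ltW r0)) ger_pMr.
Qed.

(** The distribution of the norm under Lebesgue measure. It plays the role of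
    r^(n-1) dr, of which the proof uses only that it is sigma-finite. *)
Definition radial_measure : set (measurableTypeR R) -> \bar R :=
  pushforward vol (@norm2 R n).

Let radial := measure_function_pushforward__canonical__measure_function_Measure
  vol (@measurable_norm2 R n).

Let radial0 : radial_measure set0 = 0%E.
Proof. exact: (measure0 radial). Qed.

Let radial_ge0 A : (0 <= radial_measure A)%E.
Proof. exact: (measure_ge0 radial). Qed.

Let radial_sigma_additive : semi_sigma_additive radial_measure.
Proof. exact: (@measure_semi_sigma_additive _ _ _ radial). Qed.

HB.instance Definition _ := isMeasure.Build _ _ _ radial_measure
  radial0 radial_ge0 radial_sigma_additive.

Lemma radial_measure_lty r : (radial_measure `]-oo, r] < +oo)%E.
Proof.
pose s := Num.max r 1; have s0 : 0 < s by rewrite lt_max ltr01 orbT.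
apply: (@le_lt_trans _ _ (radial_measure `]-oo, s])).
  apply: le_measure; rewrite ?inE //.
  by apply: subset_itvl; rewrite bnd_simp le_max lexx.
have := vol_dilation s0 (@measurableT _ (n.-tuple R)).
rewrite preimage_setT !setIT /radial_measure /pushforward => ->.
rewrite lte_mul_pinfty // ?lee_fin ?exprn_ge0 ?ltW //.
exact: vol_unit_ball_lty.
Qed.

Let radial_sigma_finite : sigma_finite setT radial_measure.
Proof.
exists (fun k => `]-oo, k%:R]%classic).
  apply/seteqP; split => // x _.
  exists (Num.truncn `|x|).+1 => //=; rewrite in_itv /= ltW //.
  exact: le_lt_trans (ler_norm x) (truncnS_gt _).
by move=> k; split => //; exact: radial_measure_lty.
Qed.

HB.instance Definition _ := Measure_isSigmaFinite.Build _ _ _ radial_measure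
  radial_sigma_finite.

Hypothesis n0 : (0 < n)%N.

(** The origin is invariant under the dilation by 2, which multiplies its
    finite volume by 2^n. *)
Lemma vol_norm2_eq0 : vol (@norm2 R n @^-1` [set 0]) = 0%E.
Proof.
set N := _ @^-1` _.
have mN : measurable N by rewrite -[N]setTI; exact: measurable_norm2.
have e : tscale (2 : R) @^-1` N = N.
  apply/seteqP; split => x; rewrite /N /= norm2_tscale //.
    by move=> /eqP; rewrite mulf_eq0 pnatr_eq0 /= => /eqP.
  by move=> ->; rewrite mulr0.
have := vol_tscale (ltr0n R 2 : 0 < 2) mN; rewrite e.
have : vol N \is a fin_num.
  rewrite ge0_fin_numE //; apply: le_lt_trans (vol_unit_ball_lty R n).
  apply: le_measure; rewrite ?inE //; first exact: measurable_unit_ball.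
  by move=> x; rewrite /N /unit_ball /= => ->.
move=> /fineK <-; rewrite -EFinM => -[/eqP].
rewrite -subr_eq0 -[X in _ - X]mul1r -mulrBl mulf_eq0 subr_eq0.
by rewrite -natrX pnatr_eq1 (gtn_eqF (leq_ltn_trans n0 (ltn_expl n _))) // => /eqP ->.
Qed.

(** Otherwise all balls, hence the whole space, would be null, but the integral
    of the Gaussian is positive. *)
Lemma vol_unit_ball_gt0 : (0 < vol ball)%E.
Proof.
rewrite lt0e measure_ge0 andbT; apply/negP => /eqP b0.
have [_] := gauss_volume R n; apply/negP; rewrite -leNgt.
rewrite (_ : (\int[_]_x _)%E = 0%E) //; apply: null_set_integral => //.
  by have [/measurable_int] := gauss_volume R n.
have e : [set: n.-tuple R] = \bigcup_k (@norm2 R n @^-1` `]-oo, k.+1%:R]).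
  apply/seteqP; split => // x _; exists (Num.truncn (norm2 x)) => //=.
  by rewrite in_itv /= ltW // truncnS_gt.
apply: (measure_negligible measurableT); rewrite e.
apply: negligible_bigcup => k; apply/negligibleP.
  by rewrite -[X in measurable X]setTI; exact: measurable_norm2.
have := vol_dilation (ltr0Sn R k) (@measurableT _ (n.-tuple R)).
rewrite preimage_setT !setIT => h; apply: (etrans h).
by rewrite (_ : _ @^-1` _ = ball) // b0 mule0.
Qed.

(** The image of Lebesgue measure under polar coordinates is a product measure.
    For a half-line I this is the homogeneity of the volume together with the
    definition of the surface measure by cones; half-lines determine the
    measure. *)
Lemma vol_sector (I : set (measurableTypeR R)) A : measurable I -> measurable A ->
  vol (@norm2 R n @^-1` I `&` @normalise R n @^-1` A) =
  (radial_measure I * sigma A)%E.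
Proof.
move=> mI mA.
have mnA : measurable (@normalise R n @^-1` A).
  by rewrite -[X in measurable X]setTI; exact: measurable_normalise.
have mn (J : set (measurableTypeR R)) : measurable J -> measurable (@norm2 R n @^-1` J).
  by move=> mJ; rewrite -[X in measurable X]setTI; exact: measurable_norm2.
have mn2 : measurable_fun setT (@norm2 R n : _ -> measurableTypeR R).
  exact: measurable_norm2.
pose m1 := measure_function_pushforward__canonical__measure_function_Measure
  (mrestr vol mnA) mn2.
have sA : sigma A = (fine (sigma A))%:E by rewrite fineK // sphere_measure_fin_num.
have sA0 : 0 <= fine (sigma A) by exact: fine_ge0.
pose m2 := mscale (NngNum sA0) radial_measure.
suff e : m1 I = m2 I by rewrite muleC sA; exact: e.
have V0 : fine (vol ball) != 0.
  by rewrite gt_eqF // fine_gt0 // vol_unit_ball_gt0 vol_unit_ball_lty.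
have cE : vol (@norm2 R n @^-1` `]-oo, 1%R] `&` @normalise R n @^-1` A) = vol (cone A).
  have mN0 := mn [set 0] (measurable_set1 _).
  (* a cone misses the origin, which is a null set *)
  rewrite (_ : _ `&` _ = cone A `|`
      (@norm2 R n @^-1` [set 0] `&` @normalise R n @^-1` A)).
    apply: measureU0; [exact: measurable_cone|exact: measurableI|].
    apply/eqP; rewrite -measure_le0 -vol_norm2_eq0.
    by apply: le_measure; rewrite ?inE //; exact: measurableI.
  rewrite coneE; apply/seteqP; split => x /=.
    move=> [x1 Ax]; have [x0|x0] := eqVneq (norm2 x) 0; first by right.
    by left; split => //; rewrite in_itv /= lt_neqAle eq_sym x0 norm2_ge0.
  by rewrite !in_itv /= => -[[? /andP[]]|[-> ?]].
have sE : (vol (cone A) = vol ball * sigma A)%E.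
  rewrite /sphere_measure -(@fineK _ (vol ball)).
    by rewrite muleA -EFinM /= mulfV // mul1e.
  by rewrite ge0_fin_numE // vol_unit_ball_lty.
pose G : set (set (measurableTypeR R)) := [set J | exists r : R, J = `]-oo, r]%classic].
apply: (@measure_unique _ _ _ G (fun k => `]-oo, k%:R]%classic)) => //.
- apply/seteqP; split => J; last first.
    by apply: smallest_sub; [exact: sigma_algebra_measurable|move=> _ [r ->]].
  apply: smallest_sub; first exact: smallest_sigma_algebra.
  move=> _ [[a b] _ <-] /=.
  rewrite (_ : `]a, b]%classic = `]-oo, b] `\` `]-oo, a]); last first.
    apply/seteqP; split => t /=; rewrite !in_itv /=.
      by move=> /andP[at_ tb]; split=> //; apply/negP; rewrite -ltNge.
    by move=> [tb /negP]; rewrite -ltNge => ->.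
  have gG r : measurable (`]-oo, r]%classic : set (g_sigma_algebraType G)).
    by apply: sub_sigma_algebra; exists r.
  exact: (@measurableD _ (g_sigma_algebraType G) _ _ (gG b) (gG a)).
- move=> _ _ [a ->] [b ->]; exists (Num.min a b).
  by apply/seteqP; split => x /=; rewrite !in_itv /= le_min => /andP.
- by move=> k; exists k%:R.
- apply/seteqP; split => // x _; exists (Num.truncn `|x|).+1 => //=.
  by rewrite in_itv /= ltW // (le_lt_trans (ler_norm x)) // truncnS_gt.
- move=> _ [r ->].
  suff : vol (@norm2 R n @^-1` `]-oo, r] `&` @normalise R n @^-1` A) =
      (radial_measure `]-oo, r] * sigma A)%E.
    move=> h; apply: (etrans h); rewrite muleC.
    exact: (congr1 (fun t => t * radial_measure `]-oo, r])%E sA).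
  have [r0|r0|r0] := ltgtP r 0.
  + have e0 : @norm2 R n @^-1` `]-oo, r] = set0.
      apply/seteqP; split => // x /=; rewrite in_itv /= => xr.
      by have := lt_le_trans r0 (norm2_ge0 x); rewrite ltNge xr.
    by rewrite /radial_measure /pushforward e0 set0I measure0 mul0e.
  + have := vol_dilation r0 (@measurableT _ (n.-tuple R)).
    rewrite preimage_setT !setIT => h.
    rewrite vol_dilation // cE sE [in RHS]/radial_measure /pushforward.
    by rewrite [X in _ = (X * _)%E]h muleA.
  + have e0 : @norm2 R n @^-1` `]-oo, r] = @norm2 R n @^-1` [set 0].
      apply/seteqP; split => x /=; rewrite in_itv /= r0; last by move=> ->.
      by move=> x0; apply/eqP; rewrite eq_le x0 norm2_ge0.
    rewrite /radial_measure /pushforward e0 vol_norm2_eq0 mul0e.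
    apply/eqP; rewrite -measure_le0 -vol_norm2_eq0.
    by apply: le_measure; rewrite ?inE //; [apply: measurableI => //|]; exact: mn.
- move=> k; apply: le_lt_trans (radial_measure_lty k%:R).
  apply: le_measure; rewrite ?inE //; [apply: measurableI => //|]; exact: mn.
Qed.

Definition polar (x : n.-tuple R) : measurableTypeR R * n.-tuple R :=
  (norm2 x, normalise x).

Lemma measurable_polar : measurable_fun setT polar.
Proof.
apply/measurable_fun_pairP; split; first exact: measurable_norm2.
exact: measurable_normalise.
Qed.

(** Fubini for the product measure of [vol_sector]. *)
Lemma integral_polar (g : R -> R) (h : n.-tuple R -> R) :
  measurable_fun setT g -> measurable_fun setT h ->
  radial_measure.-integrable setT (EFin \o g) ->
  sigma.-integrable setT (EFin \o h) ->
  vol.-integrable setT (fun x => (g (norm2 x) * h (normalise x))%:E) ->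
  \int[vol]_x (g (norm2 x) * h (normalise x)) =
  (\int[radial_measure]_r g r) * \int[sigma]_(z in @sphere R n) h z.
Proof.
move=> mg mh ig ih igh.
pose F (z : measurableTypeR R * n.-tuple R) := (g z.1 * h z.2)%:E.
have mF : measurable_fun setT F.
  apply/measurable_EFinP; apply: measurable_funM.
    exact: (measurableT_comp mg measurable_fst).
  exact: (measurableT_comp mh measurable_snd).
pose M := measure_function_pushforward__canonical__measure_function_Measure
  vol measurable_polar.
have ME A : measurable A -> (radial_measure \x sigma)%E A = M A.
  apply: product_measure_unique => I A' mI mA'; rewrite -vol_sector //.
have iM : M.-integrable setT F.
  exact: (integrable_pushforward measurable_polar mF).
have iP : (radial_measure \x sigma)%E.-integrable setT F.
  move/integrableP : iM => [_ iM]; apply/integrableP; split => //.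
  by rewrite (eq_measure_integral M) // => A mA _; exact: ME.
have E : (\int[vol]_x (g (norm2 x) * h (normalise x))%:E =
    \int[radial_measure]_r (g r)%:E * \int[sigma]_z (h z)%:E)%E.
  transitivity (\int[M]_z F z)%E.
    by rewrite /M (integral_pushforward measurable_polar mF).
  transitivity (\int[(radial_measure \x sigma)%E]_z F z)%E.
    by apply: eq_measure_integral => A mA _; rewrite -ME.
  rewrite -integral12_prod_meas1 // /fubini_F /F /=.
  under eq_integral => r _ do under eq_integral => z _ do rewrite EFinM.
  under eq_integral => r _ do rewrite integralZl //.
  rewrite -(fineK (integrable_fin_num measurableT ih)) integralZr //.
have -> : \int[sigma]_(z in @sphere R n) h z = \int[sigma]_z h z.
  rewrite /Rintegral (negligible_integral (N := ~` @sphere R n) _ measurableT) //.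
  - by rewrite setTD setCK.
  - exact: measurableC (@measurable_sphere R n).
  - exact: sphere_measureC.
rewrite /Rintegral E fineM //; exact: integrable_fin_num.
Qed.

End polar_integration.

(** * Moments of the sphere *)

Section sphere_moments.
Context (R : realType) (n : nat).
Local Notation vol := (lebesgue_tuple R n).
Local Notation sigma := (@sphere_measure R n).
Local Notation S := (@sphere R n).

Lemma sphere_coord_le1 (z : n.-tuple R) i : S z -> `|tnth z i| <= 1.
Proof.
move=> Sz; rewrite -(@ler_pXn2r _ 2) ?nnegrE // expr1n real_normK ?num_real //.
have := sqr_norm2 z; rewrite [norm2 z]Sz expr1n => ->.
by rewrite (bigD1 i) //= lerDl sumr_ge0 // => j _; exact: sqr_ge0.
Qed.

Definition monomial (a : 'I_n -> nat) (z : n.-tuple R) : R :=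
  \prod_(i < n) tnth z i ^+ a i.

Lemma measurable_monomial a : measurable_fun setT (monomial a).
Proof.
apply: measurable_prod => i _; apply: measurable_funX.
exact: measurable_tnth.
Qed.

Lemma monomial_le1 a z : S z -> `|monomial a z| <= 1.
Proof.
move=> Sz; rewrite normr_prod; apply: prodr_ile1 => i _; rewrite normr_ge0 normrX exprn_ile1 //.
exact: sphere_coord_le1.
Qed.

Lemma integrable_sphere_bounded (h : n.-tuple R -> R) (M : R) :
  measurable_fun setT h -> (forall z, S z -> `|h z| <= M) ->
  sigma.-integrable setT (EFin \o h).
Proof.
move=> mh hM.
have mS : measurable S := @measurable_sphere R n.
have mh' : measurable_fun setT (EFin \o h) by exact/measurable_EFinP.
apply: (negligible_integrable (measurableC mS) measurableT mh'
  (sphere_measureC R n)).2.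
rewrite setTD setCK; apply: measurable_bounded_integrable => //.
- by rewrite -ge0_fin_numE // sphere_measure_fin_num.
- exact: measurable_funTS.
- exists M; split; first exact: num_real.
  by move=> x Mx z Sz /=; apply: le_trans (ltW Mx); exact: hM.
Qed.

(** The product over the coordinates of these weights dominates |x|^d times the
    Gaussian, and it is integrable by Fubini. *)
Lemma integrable_gauss_weight d :
  (@lebesgue_measure R).-integrable setT
    (EFin \o (fun t : R => (1 + t ^+ 2) ^+ d * gauss_fun t)).
Proof.
have := @integrable_sum _ _ _ (@lebesgue_measure R) setT measurableT _
  (index_enum 'I_d.+1) xpredT
  (fun i t => ('C(d, i)%:R)%:E * (gaussX (2 * i) t)%:E)%E.
have H i : (@lebesgue_measure R).-integrable setT
    (fun t => ('C(d, i)%:R)%:E * (gaussX (2 * i) t)%:E)%E.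
  exact: (integrableZl measurableT _ (integrable_gaussX _ _)).
move=> /(_ (fun i _ => H i)); apply: eq_integrable => // t _ /=.
rewrite sumEFin; congr EFin; rewrite exprDn mulr_suml; apply: eq_bigr => i _.
by rewrite expr1n mul1r -exprM /gaussX mulr_natl mulrnAl.
Qed.

Lemma sqr_norm2_le (x : n.-tuple R) :
  norm2 x ^+ 2 <= \prod_(i < n) (1 + tnth x i ^+ 2).
Proof.
rewrite sqr_norm2.
suff /andP[_] : (0 <= \sum_(i < n) tnth x i ^+ 2) &&
    (1 + \sum_(i < n) tnth x i ^+ 2 <= \prod_(i < n) (1 + tnth x i ^+ 2)).
  by apply: le_trans; rewrite lerDr.
elim/big_rec2 : _ => [|i q s _ /andP[s0 h]]; first by rewrite addr0 !lexx.
have s2 := sqr_ge0 (tnth x i).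
rewrite addr_ge0 //=; nra.
Qed.

Lemma integrable_norm2X_gauss d :
  vol.-integrable setT (fun x => (`|norm2 x| ^+ d * gauss_fun (norm2 x))%:E).
Proof.
have [iw _] := integral_tuple_prod (fun i : 'I_n => integrable_gauss_weight d).
apply: le_integrable iw => //.
  apply/measurable_EFinP; apply: measurable_funM.
    apply: measurable_funX; apply: measurableT_comp => //; exact: measurable_norm2.
  exact: (measurableT_comp measurable_gauss_fun (@measurable_norm2 R n)).
move=> x _; rewrite !abse_EFin lee_fin; apply: le_trans (ler_norm _).
rewrite big_split /= ger0_norm; last first.
  by rewrite mulr_ge0 ?exprn_ge0 ?gauss_fun_ge0.
have -> : \prod_(i < n) gauss_fun (tnth x i) = gauss_fun (norm2 x).
  by rewrite /gauss_fun -expR_sum sumrN sqr_norm2.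
rewrite ler_wpM2r ?gauss_fun_ge0 // prodrXl.
rewrite lerXn2r ?nnegrE //; first by rewrite prodr_ge0 // => i _; rewrite addr_ge0 // sqr_ge0.
have := sqr_norm2_le x; set q := \prod_(i < n) _ => xq.
have q1 : 1 <= q.
  by rewrite /q; elim/big_ind : _ => // [y z y1 z1|i _]; [nra|rewrite lerDl sqr_ge0].
rewrite ger0_norm ?norm2_ge0 //; have := norm2_ge0 x; nra.
Qed.

(** The absolute value makes the weight nonnegative on the whole line, on which
    the radial measure lives. *)
Definition radial_gauss_moment d : R :=
  \int[@radial_measure R n]_r (`|r| ^+ d * gauss_fun r).

Lemma measurable_radial_weight d :
  measurable_fun setT (fun r : R => `|r| ^+ d * gauss_fun r).
Proof.
apply: measurable_funM; last exact: measurable_gauss_fun.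
exact: measurable_funX.
Qed.

Lemma integrable_radial_weight d : (@radial_measure R n).-integrable setT
  (EFin \o (fun r : R => `|r| ^+ d * gauss_fun r)).
Proof.
have mn2 : measurable_fun setT (@norm2 R n : _ -> measurableTypeR R).
  exact: measurable_norm2.
have mw : measurable_fun setT
    (EFin \o (fun r : measurableTypeR R => `|r| ^+ d * gauss_fun r)).
  by apply/measurable_EFinP; exact: measurable_radial_weight.
exact: (integrable_pushforward mn2 mw (integrable_norm2X_gauss d) measurableT).
Qed.

Hypothesis n0 : (0 < n)%N.

Lemma radial_gauss_moment_neq0 d : radial_gauss_moment d != 0.
Proof.
apply/negP => /eqP C0.
have ig := integrable_radial_weight d.
have : ae_eq (@radial_measure R n) setT
    (EFin \o (fun r : R => `|r| ^+ d * gauss_fun r)) (cst 0%E).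
  apply/ae_eq_integral_abs => //; first exact: measurable_int ig.
  have := integrable_fin_num measurableT ig.
  move: C0; rewrite /radial_gauss_moment /Rintegral => C0 /fineK.
  rewrite C0 => e; rewrite [RHS]e; apply: eq_integral => r _.
  by rewrite /= ger0_norm // mulr_ge0 ?exprn_ge0 ?gauss_fun_ge0.
move=> [N [mN N0 subN]].
have : (vol (@unit_ball R n) <= 0)%E.
  have mN' : measurable (@norm2 R n @^-1` N).
    by rewrite -[X in measurable X]setTI; exact: measurable_norm2.
  have mZ : measurable (@norm2 R n @^-1` [set 0]).
    by rewrite -[X in measurable X]setTI; exact: measurable_norm2.
  rewrite -(null_set_setU mN' mZ N0 (vol_norm2_eq0 R n0)).
  apply: le_measure; rewrite ?inE //; first exact: measurable_unit_ball.
    exact: measurableU.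
  move=> x _; have [x0|x0] := eqVneq (norm2 x) 0; [by right|left].
  apply: subN => /=; apply/not_implyP; split=> // -[/eqP].
  by rewrite mulf_eq0 expf_eq0 normr_eq0 (negbTE x0) andbF (gt_eqF (expR_gt0 _)).
by rewrite leNgt vol_unit_ball_gt0.
Qed.

(** Polar coordinates turn a Gaussian moment into a radial factor, which only
    depends on the degree, times the moment of the sphere. *)
Lemma gauss_sphere_moment a :
  \prod_(i < n) gauss_moment R (a i) =
  radial_gauss_moment (\sum_(i < n) a i) *
  \int[sigma]_(z in S) monomial a z.
Proof.
set d := (\sum_(i < n) a i)%N.
have E x : monomial a x * gauss_fun (norm2 x) =
    (`|norm2 x| ^+ d * gauss_fun (norm2 x)) * monomial a (normalise x).
  rewrite mulrAC; congr (_ * _).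
  rewrite -[in LHS](normaliseK x) /monomial /d -prodrXr -big_split /=.
  by apply: eq_bigr => i _; rewrite tnth_mktuple exprMn ger0_norm // norm2_ge0.
have [im <-] : vol.-integrable setT
    (fun x => (monomial a x * gauss_fun (norm2 x))%:E) /\
    \int[vol]_x (monomial a x * gauss_fun (norm2 x)) =
    \prod_(i < n) gauss_moment R (a i).
  have [h1 h2] := integral_gauss_monomial R a; split => //.
  by rewrite /Rintegral [X in fine X]h2.
rewrite -integral_polar //.
- by apply: eq_Rintegral => x _; exact: E.
- exact: measurable_radial_weight.
- exact: measurable_monomial.
- exact: integrable_radial_weight.
- exact: (integrable_sphere_bounded (measurable_monomial a) (@monomial_le1 a)).
- by apply: eq_integrable im => // x _; rewrite E.
Qed.

End sphere_moments.

(** * Density of the polynomials in the square-integrable functions *)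

Section polynomial_density.
Import HBNNSimple.
Context (R : realType) (n : nat).
Variable sigma : {finite_measure set (n.-tuple R) -> \bar R}.
Variable S : set (n.-tuple R).
Hypothesis mS : measurable S.
Hypothesis S1 : forall z i, S z -> `|tnth z i| <= 1.
Implicit Types (f g h q : n.-tuple R -> R) (A : set (n.-tuple R)).

Inductive polyf : (n.-tuple R -> R) -> Prop :=
| polyf_cst c : polyf (fun=> c)
| polyf_coord i : polyf (fun z => tnth z i)
| polyf_add f g : polyf f -> polyf g -> polyf (fun z => f z + g z)
| polyf_mul f g : polyf f -> polyf g -> polyf (fun z => f z * g z).

Definition bfun f := measurable_fun S f /\ exists M, forall z, S z -> `|f z| <= M.

Lemma bfun_cst c : bfun (fun=> c).
Proof. by split; [exact: measurable_cst|exists `|c|]. Qed.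

Lemma bfunD f g : bfun f -> bfun g -> bfun (fun z => f z + g z).
Proof.
move=> [mf [M fM]] [mg [N gN]]; split; first exact: measurable_funD.
exists (M + N) => z Sz; rewrite (le_trans (ler_normD _ _)) // lerD //.
  exact: fM.
exact: gN.
Qed.

Lemma bfunM f g : bfun f -> bfun g -> bfun (fun z => f z * g z).
Proof.
move=> [mf [M fM]] [mg [N gN]]; split; first exact: measurable_funM.
by exists (M * N) => z Sz; rewrite normrM ler_pM // ?fM // gN.
Qed.

Lemma bfunB f g : bfun f -> bfun g -> bfun (fun z => f z - g z).
Proof.
move=> bf bg; have := bfunD bf (bfunM (bfun_cst (-1)) bg).
by under eq_fun do rewrite mulN1r.
Qed.

Lemma bfunX f k : bfun f -> bfun (fun z => f z ^+ k).
Proof.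
move=> bf; elim: k => [|k IH]; first exact: bfun_cst.
by under eq_fun do rewrite exprS; exact: bfunM.
Qed.

Lemma polyf_bfun q : polyf q -> bfun q.
Proof.
elim=> [c|i|f g _ bf _ bg|f g _ bf _ bg].
- exact: bfun_cst.
- split; last by exists 1 => z /S1.
  by apply: measurable_funTS; exact: measurable_tnth.
- exact: bfunD.
- exact: bfunM.
Qed.

Lemma integrable_bfun f : bfun f -> sigma.-integrable S (EFin \o f).
Proof.
move=> [mf [M fM]]; apply: measurable_bounded_integrable => //.
  by rewrite -ge0_fin_numE // fin_num_measure.
exists M; split; first exact: num_real.
by move=> x Mx z Sz /=; apply: le_trans (ltW Mx); exact: fM.
Qed.

Definition dist2 f g : R := \int[sigma]_(z in S) (f z - g z) ^+ 2.

Lemma dist2_le f g h c d : bfun f -> bfun g -> bfun h ->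
  (forall z, S z -> f z <= c * g z + d * h z) ->
  \int[sigma]_(z in S) f z <=
  c * (\int[sigma]_(z in S) g z) + d * \int[sigma]_(z in S) h z.
Proof.
move=> bf bg bh fgh.
have bZ k x : bfun x -> bfun (fun z => k * x z) by apply: bfunM; exact: bfun_cst.
rewrite -!RintegralZl //; try exact: integrable_bfun.
rewrite -RintegralD //; try by apply: integrable_bfun; exact: bZ.
apply: le_Rintegral => //; apply: integrable_bfun => //.
by apply: bfunD; exact: bZ.
Qed.

Lemma dist2_triangle f g h : bfun f -> bfun g -> bfun h ->
  dist2 f h <= 2 * dist2 f g + 2 * dist2 g h.
Proof.
move=> bf bg bh; apply: dist2_le; try by apply: bfunX; exact: bfunB.
by move=> z _; have := sqr_ge0 (f z - 2 * g z + h z); nra.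
Qed.

Definition papprox f := bfun f /\
  forall e, 0 < e -> exists2 q, polyf q & dist2 f q <= e.

Lemma dist2ff f : dist2 f f = 0.
Proof.
rewrite /dist2 (@eq_Rintegral _ _ _ _ _ (fun=> 0)) => [|z _].
  by rewrite Rintegral_cst // mul0r.
by rewrite subrr expr0n.
Qed.

Lemma papprox_poly q : polyf q -> papprox q.
Proof.
move=> pq; split; first exact: polyf_bfun.
by move=> e e0; exists q => //; rewrite dist2ff ltW.
Qed.

Lemma papprox_closed f : bfun f ->
  (forall e, 0 < e -> exists2 g, papprox g & dist2 f g <= e) -> papprox f.
Proof.
move=> bf fg; split => // e e0.
have e4 : 0 < e / 4 by rewrite divr_gt0.
have [g [bg gq] fge] := fg _ e4; have [q pq gqe] := gq _ e4.
exists q => //; apply: le_trans (dist2_triangle bf bg (polyf_bfun pq)) _.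
lra.
Qed.

Lemma papproxD f g : papprox f -> papprox g -> papprox (fun z => f z + g z).
Proof.
move=> [bf fq] [bg gq]; split; first exact: bfunD.
move=> e e0; have e4 : 0 < e / 4 by rewrite divr_gt0.
have [p pp fp] := fq _ e4; have [q pq gqe] := gq _ e4.
exists (fun z => p z + q z); first exact: polyf_add.
have bp := polyf_bfun pp; have bq := polyf_bfun pq.
apply: (@le_trans _ _ (2 * dist2 f p + 2 * dist2 g q)); last by lra.
apply: dist2_le; try by apply: bfunX; apply: bfunB; do ?exact: bfunD.
by move=> z _; have := sqr_ge0 ((f z - p z) - (g z - q z)); nra.
Qed.

Lemma dist2_mul f g h M : bfun f -> bfun g -> bfun h -> 
  (forall z, S z -> `|h z| <= M) ->
  dist2 (fun z => f z * h z) (fun z => g z * h z) <= M ^+ 2 * dist2 f g.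
Proof.
move=> bf bg bh hM.
have := @dist2_le (fun z => (f z * h z - g z * h z) ^+ 2)
  (fun z => (f z - g z) ^+ 2) (fun z => (f z - g z) ^+ 2) (M ^+ 2) 0.
rewrite mul0r addr0; apply; try by apply: bfunX; apply: bfunB; do ?exact: bfunM.
move=> z Sz; rewrite mul0r addr0 -mulrBl exprMn mulrC.
rewrite ler_wpM2r ?sqr_ge0 // -[_ ^+ 2]real_normK ?num_real //.
by rewrite lerXn2r ?nnegrE ?hM // (le_trans _ (hM z Sz)).
Qed.

Lemma papproxM f g : papprox f -> papprox g -> papprox (fun z => f z * g z).
Proof.
move=> [bf fq] [bg gq]; split; first exact: bfunM.
move=> e e0.
have [mg [N gN]] := bg.
have [M [M0 gM]] : exists M, 0 < M /\ forall z, S z -> `|g z| <= M.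
  exists (`|N| + 1); split; first by rewrite ltr_wpDl.
  by move=> z /gN gz; rewrite (le_trans gz) // (le_trans (ler_norm _)) // lerDl.
have eM : 0 < e / (4 * M ^+ 2) by rewrite divr_gt0 // mulr_gt0 // exprn_gt0.
have [p pp fp] := fq _ eM.
have bp := polyf_bfun pp; have [mp [K pK]] := bp.
have [L [L0 pL]] : exists L, 0 < L /\ forall z, S z -> `|p z| <= L.
  exists (`|K| + 1); split; first by rewrite ltr_wpDl.
  by move=> z /pK pz; rewrite (le_trans pz) // (le_trans (ler_norm _)) // lerDl.
have eL : 0 < e / (4 * L ^+ 2) by rewrite divr_gt0 // mulr_gt0 // exprn_gt0.
have [q pq gqe] := gq _ eL; have bq := polyf_bfun pq.
exists (fun z => p z * q z); first exact: polyf_mul.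
apply: le_trans (dist2_triangle (bfunM bf bg) (bfunM bp bg) (bfunM bp bq)) _.
have h1 := dist2_mul bf bp bg gM.
have h2 := dist2_mul bg bq bp pL.
have E : dist2 (fun z => p z * g z) (fun z => p z * q z) =
    dist2 (fun z => g z * p z) (fun z => q z * p z).
  by apply: eq_Rintegral => z _; rewrite ![p z * _]mulrC.
rewrite E.
have k1 : M ^+ 2 * dist2 f p <= e / 4.
  apply: (@le_trans _ _ (M ^+ 2 * (e / (4 * M ^+ 2)))).
    by rewrite ler_wpM2l // exprn_ge0 // ltW.
  by rewrite le_eqVlt; apply/orP; left; apply/eqP; field; rewrite gt_eqF.
have k2 : L ^+ 2 * dist2 g q <= e / 4.
  apply: (@le_trans _ _ (L ^+ 2 * (e / (4 * L ^+ 2)))).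
    by rewrite ler_wpM2l // exprn_ge0 // ltW.
  by rewrite le_eqVlt; apply/orP; left; apply/eqP; field; rewrite gt_eqF.
lra.
Qed.

Lemma papprox_cst c : papprox (fun=> c).
Proof. exact/papprox_poly/polyf_cst. Qed.

Lemma papproxB f g : papprox f -> papprox g -> papprox (fun z => f z - g z).
Proof.
move=> pf pg; have := papproxD pf (papproxM (papprox_cst (-1)) pg).
by under eq_fun do rewrite mulN1r.
Qed.

Lemma papproxX f k : papprox f -> papprox (fun z => f z ^+ k).
Proof.
move=> pf; elim: k => [|k IH]; first exact: papprox_cst.
by under eq_fun do rewrite exprS; exact: papproxM.
Qed.

Lemma eq_papprox f g : (forall z, S z -> f z = g z) -> papprox f -> papprox g.
Proof.
move=> fg [[mf [M fM]] fq]; split; first split.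
- by apply: eq_measurable_fun mf => z; rewrite inE; exact: fg.
- by exists M => z Sz; rewrite -fg // fM.
- move=> e /fq[q pq h]; exists q => //; move: h; congr (_ <= _).
  by apply: eq_Rintegral => z; rewrite inE => Sz; rewrite fg.
Qed.

(** Dominated convergence gives convergence in L^2. *)
Lemma papprox_lim (f_ : nat -> n.-tuple R -> R) f M :
    (forall k, papprox (f_ k)) -> (forall k z, S z -> `|f_ k z| <= M) ->
    (forall z, S z -> f_ k z @[k --> \oo] --> f z) ->
  papprox f.
Proof.
move=> pf fM cf.
have fb z : S z -> `|f z| <= M.
  move=> Sz; have /cvg_norm := cf z Sz.
  move=> c; rewrite -(cvg_lim _ c) //; apply: limr_le.
    by apply/cvg_ex; exists `|f z|.
  by apply: nearW => k; exact: fM.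
have mf : measurable_fun S f.
  apply: (measurable_fun_cvg (h := f_)) => // k; by have [[]] := pf k.
have bf : bfun f by split => //; exists M.
apply: papprox_closed => // e e0.
have cv : dist2 f (f_ k) @[k --> \oo] --> (0 : R).
  apply: fine_cvg.
  rewrite (_ : 0%:E = (\int[sigma]_(z in S) (cst 0%E z))%E); last first.
    by rewrite integral0.
  apply: (@dominated_cvg _ _ _ sigma S mS _ _ (fun=> ((2 * M) ^+ 2)%:E)).
  - move=> k; apply/measurable_EFinP; apply: measurable_funX.
    by apply: measurable_funB => //; have [[]] := pf k.
  - move=> z Sz; apply: cvg_EFin; first exact: nearW.
    have c : f z - f_ k z @[k --> \oo] --> (0 : R).
      by rewrite -(subrr (f z)); apply: cvgB; [exact: cvg_cst|exact: cf].
    rewrite /= -(mulr0 (0 : R)); exact: (cvgM c c).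
  - by [].
  - exact: (finite_measure_integrable_cst sigma ((2 * M) ^+ 2) mS).
  - move=> k z Sz; rewrite lee_fin normrX lerXn2r ?nnegrE //.
      by rewrite mulr_ge0 // (le_trans _ (fb z Sz)).
    by rewrite (le_trans (ler_normB _ _)) // mulr2n mulrDl mul1r lerD ?fb ?fM.
have := cvgr0_norm_le _ cv _ e0; move=> [k _ /(_ k (leqnn _)) h].
exists (f_ k) => //; exact: le_trans (ler_norm _) h.
Qed.

(** These sets form a sigma-algebra that contains the half-spaces; hence it
    contains every Borel set. *)
Definition approx_set A := measurable A /\ papprox \1_A.

Lemma approx_setC A : approx_set A -> approx_set (~` A).
Proof.
move=> [mA pA]; split; first exact: measurableC.
have := papproxB (papprox_cst 1) pA; apply: eq_papprox.
by move=> z _; rewrite !indicE in_setC; case: (z \in A); rewrite /= ?subrr ?subr0.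
Qed.

Lemma papprox_prod (F : nat -> n.-tuple R -> R) k : (forall i, papprox (F i)) ->
  papprox (fun z => \prod_(i < k) F i z).
Proof.
move=> pF; elim: k => [|k IH].
  by under eq_fun do rewrite big_ord0; exact: papprox_cst.
by under eq_fun do rewrite big_ord_recr; exact: papproxM.
Qed.

Lemma approx_set_bigcap (F : nat -> set (n.-tuple R)) :
  (forall i, approx_set (F i)) -> approx_set (\bigcap_i F i).
Proof.
move=> aF; split; first by apply: bigcapT_measurable => i; have [] := aF i.
apply: (@papprox_lim (fun k z => \prod_(i < k) \1_(F i) z) _ 1).
- by move=> k; apply: (@papprox_prod (fun i => \1_(F i))) => i; have [] := aF i.
- move=> k z _; rewrite normr_prod; apply: prodr_ile1 => i _.
  by rewrite normr_ge0 indicE; case: (_ \in _); rewrite /= ?normr1 ?normr0 ?lexx ?ler01.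
move=> z _; have [Fz|] := pselect (forall i, F i z).
  rewrite indicE mem_set; last by move=> i _.
  apply: cvg_near_cst; apply: nearW => k; rewrite big1 // => i _.
  by rewrite indicE mem_set.
move/existsNP => [j Fj]; rewrite indicE memNset; last by move/(_ j I).
apply: cvg_near_cst; exists j.+1 => // k /= jk.
by rewrite (bigD1 (Ordinal jk)) //= indicE memNset // mul0r.
Qed.

Lemma sigma_algebra_approx_set : sigma_algebra setT approx_set.
Proof.
split.
- split; first exact: measurable0.
  by rewrite indic0; exact: papprox_cst.
- by move=> A aA; rewrite setTD; exact: approx_setC.
- move=> F aF; rewrite -[X in approx_set X]setCK setC_bigcup.
  by apply: approx_setC; apply: approx_set_bigcap => i; exact: approx_setC.
Qed.

Lemma bernoulli_ineq (y : R) k : 0 <= 1 + y -> 1 + k%:R * y <= (1 + y) ^+ k.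
Proof.
move=> y0; elim: k => [|k IH]; first by rewrite mul0r addr0.
rewrite exprS -[k.+1]addn1 natrD.
have : (1 + y) * (1 + k%:R * y) <= (1 + y) * (1 + y) ^+ k by rewrite ler_wpM2l.
apply: le_trans; have := ler0n R k; have := sqr_ge0 y; nra.
Qed.

Lemma papprox_affine c d i : papprox (fun z => c * tnth z i + d).
Proof.
apply: papprox_poly => //; apply: polyf_add; last exact: polyf_cst.
by apply: polyf_mul; [exact: polyf_cst|exact: polyf_coord].
Qed.

(** The scaling for which 1/2 + slope a * (t - a) has values in [0, 1] whenever
    |t| <= 1. *)
Let slope (a : R) : R := (2 * (1 + `|a|))^-1.

Let slope_gt0 a : 0 < slope a.
Proof. by rewrite invr_gt0 mulr_gt0 // ltr_wpDr. Qed.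

Let slope_le a z i : S z -> `|slope a * (tnth z i - a)| <= 2^-1.
Proof.
move=> Sz; rewrite normrM (gtr0_norm (slope_gt0 a)) /slope invfM -mulrA.
rewrite ler_piMr ?invr_ge0 // ler_pdivrMl ?mulr1; last by rewrite ltr_wpDr.
by rewrite (le_trans (ler_normB _ _)) // lerD // S1.
Qed.

(** The limit of 1 - (1 - g)^k, for a polynomial g with values in [0, 1] that
    vanishes exactly on the hyperplane. *)
Lemma approx_set_neq i a : approx_set [set z | tnth z i != a].
Proof.
have mA : measurable [set z : n.-tuple R | tnth z i != a].
  rewrite (_ : [set z | _] = ~` ((@tnth n R ^~ i) @^-1` [set a])).
    apply: measurableC; rewrite -[X in measurable X]setTI.
    exact: measurable_tnth.
  by apply/seteqP; split => z /= /eqP.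
split => //.
pose g z := (slope a * tnth z i - slope a * a) ^+ 2.
have pg : papprox g by apply: papproxX => //; exact: papprox_affine.
have g01 z : S z -> 0 <= 1 - g z <= 1.
  move=> Sz; rewrite /g -mulrBr; have := slope_le a i Sz; rewrite ler_norml.
  by move=> /andP[h1 h2]; have := sqr_ge0 (slope a * (tnth z i - a)); nra.
apply: (@papprox_lim (fun k z => 1 - (1 - g z) ^+ k) _ 1).
- move=> k; apply: papproxB => //; first exact: papprox_cst.
  by apply: papproxX => //; apply: papproxB => //; exact: papprox_cst.
- move=> k z /g01 /andP[h0 h1].
  have := exprn_ge0 k h0; have := exprn_ile1 k h0 h1.
  by move=> h2 h3; rewrite ger0_norm; lra.
move=> z Sz; rewrite indicE.
have [za|za] := eqVneq (tnth z i) a.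
  rewrite memNset /=; last by rewrite za eqxx.
  apply: cvg_near_cst; apply: nearW => k.
  by rewrite /g za subrr expr0n /= subr0 expr1n subrr.
rewrite mem_set //= -[X in _ --> X]subr0; apply: cvgB; first exact: cvg_cst.
apply: cvg_expr; have /andP[h0 h1] := g01 z Sz; rewrite ger0_norm //.
rewrite ltrBlDr ltrDl /g -mulrBr exprn_even_gt0 //= mulf_neq0 ?subr_eq0 //.
by rewrite gt_eqF.
Qed.

(** The limit of (1 - g^k)^(2^k), for an affine g with values in [0, 1], is 1
    where g < 1/2 and 0 where g > 1/2 by the inequality of Bernoulli, as in the
    proof of the Stone-Weierstrass theorem by Brosowski and Deutsch. On the
    hyperplane g = 1/2 the limit is 1/e, hence the factor that removes it. *)
Lemma approx_set_lt i a : approx_set [set z | tnth z i < a].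
Proof.
have mA : measurable [set z : n.-tuple R | tnth z i < a].
  rewrite (_ : [set z | _] = ((@tnth n R ^~ i) @^-1` `]-oo, a[)).
    rewrite -[X in measurable X]setTI.
    exact: measurable_tnth.
  by apply/seteqP; split => z /=; rewrite in_itv.
split => //.
pose g z := slope a * tnth z i + (2^-1 - slope a * a).
have pg : papprox g by exact: papprox_affine.
have gE z : g z = 2^-1 + slope a * (tnth z i - a) by rewrite /g; ring.
have g01 z : S z -> 0 <= g z <= 1.
  by move=> Sz; rewrite gE; have := slope_le a i Sz; rewrite ler_norml; lra.
pose h k z := (1 - g z ^+ k) ^+ (2 ^ k) * \1_[set z | tnth z i != a] z.
have gk01 k z : S z -> 0 <= g z ^+ k <= 1.
  by move=> /g01 /andP[h0 h1]; rewrite exprn_ge0 //= exprn_ile1.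
apply: (@papprox_lim h _ 1).
- move=> k; apply: papproxM => //; last by have [] := approx_set_neq i a.
  apply: papproxX => //; apply: papproxB => //; first exact: papprox_cst.
  exact: papproxX.
- move=> k z /(gk01 k) /andP[h0 h1]; rewrite normrM.
  rewrite mulr_ile1 ?normr_ge0 //; last first.
    by rewrite indicE; case: (_ \in _); rewrite /= ?normr1 ?normr0 ?lexx ?ler01.
  by rewrite normrX exprn_ile1 ?normr_ge0 // ger0_norm; lra.
move=> z Sz; rewrite /h !indicE.
have [za|za|za] := ltgtP (tnth z i) a.
- rewrite !mem_set //= ?lt_eqF //; under eq_fun do rewrite mulr1.
  apply: (@squeeze_cvgr _ _ _ _ (fun k => 1 - (2 * g z) ^+ k) (fun=> 1)).
  + apply: nearW => k; have /andP[h0 h1] := gk01 k z Sz; apply/andP; split.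
      have := @bernoulli_ineq (- g z ^+ k) (2 ^ k) _.
      by rewrite subr_ge0 => /(_ h1); rewrite mulrN exprMn natrX.
    by rewrite exprn_ile1; lra.
  + rewrite -[X in _ --> X]subr0; apply: cvgB; first exact: cvg_cst.
    apply: cvg_expr; have /andP[h0 h1] := g01 z Sz.
    rewrite ger0_norm ?mulr_ge0 // gE.
    have : slope a * (tnth z i - a) < 0 by rewrite pmulr_rlt0 ?subr_lt0.
    lra.
  + exact: cvg_cst.
- rewrite [X in _ --> X](_ : _ = 0); last first.
    by rewrite memNset //=; apply/negP; rewrite -leNgt ltW.
  rewrite mem_set /= ?gt_eqF //; under eq_fun do rewrite mulr1.
  have g2 : 1 < 2 * g z.
    rewrite gE; have : 0 < slope a * (tnth z i - a) by rewrite mulr_gt0 ?subr_gt0.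
    lra.
  apply: (@squeeze_cvgr _ _ _ _ (fun=> 0) (fun k => ((2 * g z)^-1) ^+ k)).
  + apply: nearW => k; have /andP[h0 h1] := gk01 k z Sz; apply/andP; split.
      by rewrite exprn_ge0; lra.
    rewrite exprVn -[leRHS]mul1r ler_pdivlMr ?exprn_gt0 ?(lt_trans _ g2) //.
    apply: (@le_trans _ _ ((1 - g z ^+ k) ^+ (2 ^ k) * (1 + g z ^+ k) ^+ (2 ^ k))).
      rewrite ler_wpM2l ?exprn_ge0 ?subr_ge0 //.
      apply: le_trans (bernoulli_ineq _ _); last by lra.
      by rewrite exprMn natrX lerDr.
    by rewrite -exprMn exprn_ile1 //; have := sqr_ge0 (g z ^+ k); nra.
  + exact: cvg_cst.
  + apply: cvg_expr; rewrite ger0_norm ?invr_ge0 ?(ltW (lt_trans _ g2)) //.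
    by rewrite invf_lt1 // (lt_trans _ g2).
- rewrite [X in _ --> X](_ : _ = 0); last first.
    by rewrite memNset //= za ltxx.
  apply: cvg_near_cst; apply: nearW => k.
  by rewrite memNset ?mulr0 //= za eqxx.
Qed.

Lemma approx_set_preimage i (B : set R) : measurable B ->
  approx_set ((@tnth n R ^~ i) @^-1` B).
Proof.
have [a0 aC aU] := sigma_algebra_approx_set.
rewrite -[measurable B]/(((@ocitv R).-sigma.-measurable) B).
rewrite RGenInftyO.measurableE.
move: B; apply: smallest_sub; last first.
  move=> _ [a ->] /=; rewrite (_ : _ @^-1` _ = [set z | tnth z i < a]).
    exact: approx_set_lt.
  by apply/seteqP; split => z /=; rewrite in_itv.
split.
- by rewrite preimage_set0.
- by move=> B aB; rewrite setTD preimage_setC; exact: approx_setC.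
- by move=> F aF; rewrite preimage_bigcup; exact: aU.
Qed.

Lemma measurable_approx_set A : measurable A -> approx_set A.
Proof.
rewrite /measurable /=; move: A; apply: smallest_sub.
  exact: sigma_algebra_approx_set.
rewrite -bigcup_seq => A [i _ [B mB <-]]; rewrite setTI.
exact: approx_set_preimage.
Qed.

Lemma papprox_sum (I : Type) (s : seq I) (F : I -> n.-tuple R -> R) :
  (forall i, papprox (F i)) -> papprox (fun z => \sum_(i <- s) F i z).
Proof.
move=> pF; elim: s => [|i s IH].
  by under eq_fun do rewrite big_nil; exact: papprox_cst.
by under eq_fun do rewrite big_cons; exact: papproxD.
Qed.

Lemma papprox_nnsfun (g : {nnsfun n.-tuple R >-> R}) : papprox g.
Proof.
apply: (eq_papprox (fun z _ => esym (fimfunEord g z))).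
pose G (y : R) z := y * \1_(g @^-1` [set y]) z.
apply: (@papprox_sum _ _ (fun i z => G (nth 0 _ (nat_of_ord i)) z)) => i.
apply: papproxM; first exact: papprox_cst.
set y := nth _ _ _; have mB : measurable (g @^-1` [set y]).
  by rewrite -[X in measurable X]setTI; exact: (@measurable_funPT _ _ _ _ g).
by have [] := measurable_approx_set mB.
Qed.

Lemma papprox_bfun f : bfun f -> papprox f.
Proof.
suff H h : bfun h -> (forall z, S z -> 0 <= h z) -> papprox h.
  move=> bf; have [mf [M fM]] := bf.
  apply: (@eq_papprox (fun z => (f z + M) - M)) => [z _|]; first by rewrite addrK.
  apply: papproxB; last exact: papprox_cst.
  apply: H => [|z Sz]; first by apply: bfunD => //; exact: bfun_cst.
  by have := fM z Sz; rewrite ler_norml => /andP[]; lra.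
move=> [mh [M hM]] h0.
have mhE : measurable_fun S (EFin \o h) by exact/measurable_EFinP.
apply: (@papprox_lim (fun k => nnsfun_approx mS mhE k) _ M).
- by move=> k; exact: papprox_nnsfun.
- move=> k z Sz; rewrite ger0_norm // (le_trans _ (hM z Sz)) // ger0_norm ?h0 //.
  by rewrite nnsfun_approxE -lee_fin le_approx // => x Sx; rewrite lee_fin h0.
- move=> z Sz.
  have /fine_cvgP[] : (EFin \o (nnsfun_approx mS mhE ^~ z)) @ \oo --> (h z)%:E.
    by apply: (cvg_nnsfun_approx mS mhE) => // x Sx; rewrite lee_fin h0.
  by [].
Qed.

Definition sqint f := measurable_fun S f /\
  sigma.-integrable S (fun z => (f z ^+ 2)%:E).

Lemma bfun_sqint f : bfun f -> sqint f.
Proof. by move=> bf; split; [by have [] := bf|exact/integrable_bfun/bfunX]. Qed.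

Lemma sqintD f g : sqint f -> sqint g -> sqint (fun z => f z + g z).
Proof.
move=> [mf sf] [mg sg]; split; first exact: measurable_funD.
have : sigma.-integrable S (fun z => 2%:E * ((f z ^+ 2)%:E + (g z ^+ 2)%:E))%E.
  by apply: integrableZl => //; exact: integrableD.
apply: le_integrable => //.
  by apply/measurable_EFinP; apply: measurable_funX; exact: measurable_funD.
move=> z _; rewrite !abse_EFin lee_fin (le_trans _ (ler_norm _)) //.
rewrite ger0_norm ?sqr_ge0 //; have := sqr_ge0 (f z - g z); nra.
Qed.

Lemma sqintZ c f : sqint f -> sqint (fun z => c * f z).
Proof.
move=> [mf sf]; split; first exact: measurable_funM.
under eq_fun do rewrite exprMn EFinM; exact: integrableZl.
Qed.

Lemma sqintB f g : sqint f -> sqint g -> sqint (fun z => f z - g z).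
Proof.
move=> sf sg; have := sqintD sf (sqintZ (-1) sg).
by under eq_fun do rewrite mulN1r.
Qed.

Lemma sqintM f g : sqint f -> sqint g ->
  sigma.-integrable S (fun z => (f z * g z)%:E).
Proof.
move=> [mf sf] [mg sg].
have : sigma.-integrable S (fun z => (f z ^+ 2)%:E + (g z ^+ 2)%:E)%E.
  exact: integrableD.
apply: le_integrable => //.
  by apply/measurable_EFinP; exact: measurable_funM.
move=> z _; rewrite !abse_EFin lee_fin (le_trans _ (ler_norm _)) // normrM.
rewrite -[f z ^+ 2]real_normK ?num_real // -[g z ^+ 2]real_normK ?num_real //.
have := normr_ge0 (f z); have := normr_ge0 (g z).
by have := sqr_ge0 (`|f z| - `|g z|); nra.
Qed.

Lemma dist2_sqint_triangle f g h : sqint f -> sqint g -> sqint h ->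
  dist2 f h <= 2 * dist2 f g + 2 * dist2 g h.
Proof.
move=> sf sg sh; rewrite /dist2.
have [_ i1] := sqintB sf sg; have [_ i2] := sqintB sg sh.
have [_ i3] := sqintB sf sh.
have Z c k : sigma.-integrable S (fun z => (k z)%:E) ->
    sigma.-integrable S (fun z => (c * k z)%:E) by exact: integrableZl.
rewrite -!RintegralZl // -RintegralD //; [|exact: Z|exact: Z].
apply: le_Rintegral => //.
  exact: (integrableD mS (Z 2 _ i1) (Z 2 _ i2)).
by move=> z _; have := sqr_ge0 (f z - 2 * g z + h z); nra.
Qed.

(** Truncate, then approximate the truncation. *)
Lemma polyf_dense f e : sqint f -> 0 < e -> exists2 q, polyf q & dist2 f q <= e.
Proof.
move=> sf e0; have [mf f2] := sf.
pose f_ (k : nat) z := Num.max (- k%:R) (Num.min (k%:R) (f z)).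
have bf k : bfun (f_ k).
  split.
    apply: measurable_maxr; first exact: measurable_cst.
    by apply: measurable_minr => //; exact: measurable_cst.
  exists k%:R => z _; rewrite ler_norml le_max lexx /= ge_max ge_min lexx /=.
  by rewrite andbT (le_trans _ (ler0n R k)) // oppr_le0.
have cv : dist2 f (f_ k) @[k --> \oo] --> (0 : R).
  apply: fine_cvg.
  rewrite (_ : 0%:E = (\int[sigma]_(z in S) (cst 0%E z))%E); last first.
    by rewrite integral0.
  apply: (@dominated_cvg _ _ _ sigma S mS _ _ (fun z => (f z ^+ 2)%:E)) => //.
  - move=> k; apply/measurable_EFinP; apply: measurable_funX.
    by apply: measurable_funB => //; have [] := bf k.
  - move=> z Sz; apply: cvg_near_cst; near=> k.
    have : `|f z| <= k%:R by apply: ltW; near: k; exact: nbhs_infty_gtr.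
    rewrite ler_norml => /andP[h1 h2].
    by rewrite /f_ (min_idPr h2) (max_idPr h1) subrr expr0n.
  - move=> k z Sz; rewrite abse_EFin lee_fin ger0_norm ?sqr_ge0 //.
    rewrite -[leLHS]real_normK ?num_real // -[leRHS]real_normK ?num_real //.
    rewrite lerXn2r ?nnegrE // /f_.
    have k0 := ler0n R k.
    have [h1|h1] := leP k%:R (f z).
      rewrite (max_idPr _); last by lra.
      by rewrite !ger0_norm; lra.
    have [h2|h2] := leP (- k%:R) (f z); first by rewrite subrr normr0.
    by rewrite !ler0_norm; lra.
have [k _ /(_ k (leqnn _)) hk] := cvgr0_norm_le _ cv _ (divr_gt0 e0 (ltr0n R 4)).
have [_ /(_ _ (divr_gt0 e0 (ltr0n R 4)))[q pq hq]] := papprox_bfun (bf k).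
exists q => //.
apply: (le_trans (dist2_sqint_triangle sf (bfun_sqint (bf k))
  (bfun_sqint (polyf_bfun pq)))).
have := le_trans (ler_norm _) hk; lra.
Unshelve. all: by end_near. Qed.

End polynomial_density.

(** * Complex integrals and the inner product *)

Section complex_integral.
Context (R : realType) (n : nat).
Local Notation C := R[i].
Local Notation sigma := (@sphere_measure R n).
Local Notation S := (@sphere R n).
Local Notation Re := (@complex.Re R).
Local Notation Im := (@complex.Im R).
Implicit Types (f g h : n.-tuple R -> C) (a : C).

Let mS : measurable S := @measurable_sphere R n.

Lemma ReP a (u v : C) : Re (a * u + v) = Re a * Re u - Im a * Im u + Re v.
Proof. by case: a u v => [? ?] [? ?] [? ?]. Qed.

Lemma ImP a (u v : C) : Im (a * u + v) = Re a * Im u + Im a * Re u + Im v.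
Proof. by case: a u v => [? ?] [? ?] [? ?]. Qed.

Definition cintegrable h :=
  sigma.-integrable S (fun z => (Re (h z))%:E) /\
  sigma.-integrable S (fun z => (Im (h z))%:E).

Let iZ (c : R) (k : n.-tuple R -> R) : sigma.-integrable S (fun z => (k z)%:E) ->
  sigma.-integrable S (fun z => (c * k z)%:E).
Proof. by move=> ik; exact: (integrableZl mS c ik). Qed.

Let iD (k l : n.-tuple R -> R) : sigma.-integrable S (fun z => (k z)%:E) ->
  sigma.-integrable S (fun z => (l z)%:E) ->
  sigma.-integrable S (fun z => (k z + l z)%:E).
Proof. by move=> ik il; exact: (integrableD mS ik il). Qed.

Let iB (k l : n.-tuple R -> R) : sigma.-integrable S (fun z => (k z)%:E) ->
  sigma.-integrable S (fun z => (l z)%:E) ->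
  sigma.-integrable S (fun z => (k z - l z)%:E).
Proof. by move=> ik il; exact: (integrableB mS ik il). Qed.

Lemma cintegrableP a f g : cintegrable f -> cintegrable g ->
  cintegrable (fun z => a * f z + g z).
Proof.
move=> [f1 f2] [g1 g2]; split.
  by under eq_fun do rewrite ReP; apply: iD => //; apply: iB; exact: iZ.
by under eq_fun do rewrite ImP; apply: iD => //; apply: iD; exact: iZ.
Qed.

Lemma cintegralP a f g : cintegrable f -> cintegrable g ->
  cintegral (fun z => a * f z + g z) = a * cintegral f + cintegral g.
Proof.
move=> [f1 f2] [g1 g2]; rewrite /cintegral.
pose I := fun k : n.-tuple R -> R => \int[sigma]_(z in S) k z.
have re : \int[sigma]_(z in S) Re (a * f z + g z) =
    Re a * I (Re \o f) - Im a * I (Im \o f) + I (Re \o g).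
  under eq_Rintegral do rewrite ReP.
  rewrite RintegralD //; last by apply: iB; exact: iZ.
  rewrite RintegralB //; [|exact: iZ|exact: iZ].
  by rewrite !RintegralZl.
have im : \int[sigma]_(z in S) Im (a * f z + g z) =
    Re a * I (Im \o f) + Im a * I (Re \o f) + I (Im \o g).
  under eq_Rintegral do rewrite ImP.
  rewrite RintegralD //; last by apply: iD; exact: iZ.
  rewrite RintegralD //; [|exact: iZ|exact: iZ].
  by rewrite !RintegralZl.
by rewrite re im; case: (a).
Qed.

Lemma cintegrable0 : cintegrable (fun=> 0).
Proof. by split; exact: integrable0. Qed.

Lemma cintegral0 : cintegral (fun _ : n.-tuple R => 0 : C) = 0.
Proof. by rewrite /cintegral /Rintegral !integral0. Qed.

Lemma cintegral_sum (I : Type) (s : seq I) (F : I -> n.-tuple R -> C) :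
  (forall i, cintegrable (F i)) ->
  cintegrable (fun z => \sum_(i <- s) F i z) /\
  cintegral (fun z => \sum_(i <- s) F i z) = \sum_(i <- s) cintegral (F i).
Proof.
move=> iF; elim: s => [|i s [IH1 IH2]].
  rewrite big_nil; under eq_fun do rewrite big_nil.
  by rewrite cintegral0; split => //; exact: cintegrable0.
rewrite big_cons; under eq_fun do rewrite big_cons -[F i _]mul1r.
split; first exact: cintegrableP.
by rewrite cintegralP // mul1r IH2.
Qed.

Lemma eq_cintegral f g : (forall z, S z -> f z = g z) -> cintegral f = cintegral g.
Proof.
move=> fg; rewrite /cintegral; congr Complex;
  by apply: eq_Rintegral => z; rewrite inE => Sz; rewrite fg.
Qed.

Lemma cintegral_conj f : cintegrable f ->
  cintegral (fun z => conjc (f z)) = conjc (cintegral f).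
Proof.
move=> [f1 f2]; rewrite /cintegral /conjc; congr Complex.
  by apply: eq_Rintegral => z _; case: (f z).
rewrite (@eq_Rintegral _ _ _ _ _ (fun z => -1 * Im (f z))) => [|z _].
  by rewrite RintegralZl // mulN1r.
by case: (f z) => ? ? /=; rewrite mulN1r.
Qed.

Definition csqint f := sqint sigma S (Re \o f) /\ sqint sigma S (Im \o f).

Lemma csqintP a f g : csqint f -> csqint g -> csqint (fun z => a * f z + g z).
Proof.
move=> [f1 f2] [g1 g2]; split.
  rewrite (_ : _ \o _ = fun z => Re a * Re (f z) - Im a * Im (f z) + Re (g z)).
    by apply: sqintD => //; apply: sqintB => //; exact: sqintZ.
  by apply/funext => z; exact: ReP.
rewrite (_ : _ \o _ = fun z => Re a * Im (f z) + Im a * Re (f z) + Im (g z)).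
  by apply: sqintD => //; apply: sqintD => //; exact: sqintZ.
by apply/funext => z; exact: ImP.
Qed.

Lemma csqintM f g : csqint f -> csqint g ->
  cintegrable (fun z => f z * conjc (g z)).
Proof.
move=> [f1 f2] [g1 g2]; split.
  rewrite (_ : (fun _ => _) = fun z => (Re (f z) * Re (g z) + Im (f z) * Im (g z))%:E).
    by apply: iD; exact: (sqintM mS).
  by apply/funext => z; case: (f z) (g z) => ? ? [? ?] /=; rewrite mulrN opprK.
rewrite (_ : (fun _ => _) = fun z => (Im (f z) * Re (g z) - Re (f z) * Im (g z))%:E).
  by apply: iB; exact: (sqintM mS).
apply/funext => z; case: (f z) (g z) => ? ? [? ?] /=; congr EFin; ring.
Qed.

Lemma cintegral_ge0 f : csqint f -> 0 <= cintegral (fun z => f z * conjc (f z)).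
Proof.
move=> sf; have E z : f z * conjc (f z) = ((Re (f z)) ^+ 2 + (Im (f z)) ^+ 2)%:C%C.
  by case: (f z) => a b; rewrite /GRing.mul /= /real_complex_def; congr Complex; ring.
rewrite (eq_cintegral (fun z _ => E z)) /cintegral lecE /=.
rewrite Rintegral_cst // mul0r eqxx /=.
by apply: Rintegral_ge0 => z _; rewrite addr_ge0 // sqr_ge0.
Qed.

Lemma bounded_csqint f : bfun S (Re \o f) -> bfun S (Im \o f) -> csqint f.
Proof. by move=> b1 b2; split; exact: (bfun_sqint _ mS). Qed.

End complex_integral.

Section inner_product.
Context (R : realType) (n p : nat).
Local Notation C := R[i].
Local Notation Cn := 'rV[C]_n.
Local Notation S := (@sphere R n).
Local Notation rot := (@Defs.rot R n p).
Implicit Types (f g h : Cn -> C) (a : C).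

Lemma L2P f : L2 p f <-> forall j, (j < p)%N -> csqint (fun z => f (rot j z)).
Proof.
have mS := @measurable_sphere R n.
split=> [Lf j jp|Lf j jp].
  have [m1 m2 fin] := Lf j jp.
  have H (k : n.-tuple R -> R) : measurable_fun S k ->
      (forall z, k z ^+ 2 <= complex.Re (f (rot j z)) ^+ 2 + complex.Im (f (rot j z)) ^+ 2) ->
      sqint (@sphere_measure R n) S k.
    move=> mk kle; split => //; apply/integrableP; split.
      by apply/measurable_EFinP; exact: measurable_funX.
    apply: le_lt_trans fin; apply: ge0_le_integral => //.
    - by apply/measurable_EFinP; apply: measurableT_comp => //; exact: measurable_funX.
    - by apply/measurable_EFinP; apply: measurable_funD; exact: measurable_funX.
    - by move=> z _; rewrite abse_EFin lee_fin ger0_norm ?sqr_ge0.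
  by split; apply: H => // z /=; [rewrite lerDl|rewrite lerDr]; exact: sqr_ge0.
have [[m1 i1] [m2 i2]] := Lf j jp; split => //.
have /integrableP[_] := integrableD mS i1 i2; apply: le_lt_trans.
apply: ge0_le_integral => //.
- by move=> z _; rewrite lee_fin addr_ge0 // sqr_ge0.
- by apply/measurable_EFinP; apply: measurable_funD; exact: measurable_funX.
- apply: measurableT_comp => //.
  by apply/measurable_EFinP; apply: measurable_funD; exact: measurable_funX.
- by move=> z _; rewrite /= lee_fin; exact: ler_norm.
Qed.

Lemma L2_lin a f g : L2 p f -> L2 p g -> L2 p (fun x => a * f x + g x).
Proof.
by move=> /L2P Lf /L2P Lg; apply/L2P => j jp; apply: csqintP; [exact: Lf|exact: Lg].
Qed.

Lemma eq_L2 f g : (forall x, Shat p x -> f x = g x) -> L2 p f -> L2 p g.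
Proof.
move=> fg Lf j jp; have [m1 m2 fin] := Lf j jp.
have E z : S z -> f (rot j z) = g (rot j z).
  by move=> Sz; apply: fg; exists j => //; exists z.
split.
- by apply: eq_measurable_fun m1 => z; rewrite inE => /E ->.
- by apply: eq_measurable_fun m2 => z; rewrite inE => /E ->.
- rewrite (eq_integral (fun z => (complex.Re (f (rot j z)) ^+ 2 +
    complex.Im (f (rot j z)) ^+ 2)%:E)) // => z.
  by rewrite inE => /E ->.
Qed.

Lemma innerE f g : L2 p f -> L2 p g ->
  inner p f g = p%:R^-1 *
    \sum_(j < p) cintegral (fun z => f (rot j z) * conjc (g (rot j z))).
Proof.
move=> /L2P Lf /L2P Lg; rewrite /inner; congr (_ * _).
have [|_ ->] // := @cintegral_sum R n 'I_p (index_enum 'I_p)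
  (fun j z => f (rot j z) * conjc (g (rot j z))).
by move=> j; apply: csqintM; [exact: Lf|exact: Lg].
Qed.

Lemma eq_inner f f' g g' : (forall x, Shat p x -> f x = f' x) ->
  (forall x, Shat p x -> g x = g' x) -> inner p f g = inner p f' g'.
Proof.
move=> ff gg; rewrite /inner; congr (_ * _); apply: eq_cintegral => z Sz.
apply: eq_bigr => j _; have hz : Shat p (rot j z) by exists j => //=; exists z.
by rewrite ff // gg.
Qed.

Lemma innerP a f g h : L2 p f -> L2 p g -> L2 p h ->
  inner p (fun x => a * f x + g x) h = a * inner p f h + inner p g h.
Proof.
move=> Lf Lg Lh; rewrite !innerE //; last exact: L2_lin.
rewrite mulrCA -mulrDr; congr (_ * _); rewrite mulr_sumr -big_split /=.
apply: eq_bigr => j _; rewrite -cintegralP.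
- by apply: eq_cintegral => z _; rewrite mulrDl mulrA.
- by apply: csqintM; [move/L2P : Lf; apply|move/L2P : Lh; apply].
- by apply: csqintM; [move/L2P : Lg; apply|move/L2P : Lh; apply].
Qed.

Lemma inner_conj f g : L2 p f -> L2 p g -> inner p g f = conjc (inner p f g).
Proof.
move=> Lf Lg; rewrite !innerE // rmorphM fmorphV rmorph_nat rmorph_sum /=.
congr (_ * _); apply: eq_bigr => j _.
transitivity (cintegral (fun z => conjc (f (rot j z) * conjc (g (rot j z))))).
  by apply: eq_cintegral => z _; rewrite rmorphM /= conjcK mulrC.
apply: cintegral_conj; apply: csqintM.
  by move/L2P : Lf; apply.
by move/L2P : Lg; apply.
Qed.

Lemma inner_ge0 f : L2 p f -> 0 <= inner p f f.
Proof.
move=> Lf; rewrite innerE // mulr_ge0 ?invr_ge0 ?ler0n //.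
by apply: sumr_ge0 => j _; apply: cintegral_ge0; move/L2P : Lf; apply.
Qed.

(** Cauchy-Schwarz for a null vector: otherwise g + c f would have a negative
    square for a suitable multiple c of f. *)
Lemma inner_null f g : L2 p f -> L2 p g -> inner p f f = 0 -> inner p f g = 0.
Proof.
move=> Lf Lg ff; apply/eqP/negP => /negP b0.
set b := inner p f g in b0.
set t := inner p g g.
have t0 : 0 <= t by exact: inner_ge0.
have tc : conjc t = t by rewrite /t -inner_conj.
pose c := - (t + 1) / (b + b).
have bb : b + b != 0 by rewrite -mulr2n mulrn_eq0 negb_or.
have cb : c * b + c * b = - (t + 1) by rewrite -mulrDr /c divfK.
have cbc : conjc (c * b) = c * b.
  have e : c * b = - (t + 1) / 2.
    by apply: (@mulIf _ 2); rewrite ?pnatr_eq0 // divfK ?pnatr_eq0 // -cb mulr2n mulrDr mulr1.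
  rewrite e rmorphM rmorphN rmorphD fmorphV rmorph1 rmorph_nat.
  by rewrite [X in - (X + _)]tc.
have Lh := L2_lin c Lf Lg.
have e1 : inner p (fun x => c * f x + g x) f = conjc b.
  by rewrite innerP // ff mulr0 add0r inner_conj.
have e2 : inner p (fun x => c * f x + g x) g = c * b + t by rewrite innerP.
have e3 : inner p f (fun x => c * f x + g x) = b.
  by rewrite (inner_conj Lh Lf) e1 conjcK.
have e4 : inner p g (fun x => c * f x + g x) = c * b + t.
  by rewrite (inner_conj Lh Lg) e2 rmorphD [X in X + _]cbc [X in _ + X]tc.
have := inner_ge0 Lh; rewrite innerP // e3 e4 addrA cb opprD addrAC addNr.
by rewrite add0r lerNr oppr0 ler10.
Qed.

End inner_product.

(** * Rotations, and polynomials on the rotated spheres *)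

Section rotations.
Context (R : realType) (p : nat).
Hypothesis p0 : (0 < p)%N.
Local Notation C := R[i].

Definition omega (j : nat) : C :=
  let t := j%:R * pi / p%:R in Complex (cos t) (sin t).

Lemma omegaD j k : omega (j + k) = omega j * omega k.
Proof.
rewrite /omega natrD !mulrDl cosD sinD /GRing.mul /=; congr Complex.
by rewrite addrC [X in X + _]mulrC.
Qed.

Lemma omega0 : omega 0 = 1.
Proof. by rewrite /omega !mul0r cos0 sin0. Qed.

Lemma omegaE j : omega j = omega 1 ^+ j.
Proof. by elim: j => [|j IH]; rewrite ?omega0 // exprS -IH -omegaD. Qed.

Lemma omega_mulJ j : omega j * conjc (omega j) = 1.
Proof.
rewrite /omega /GRing.mul /=; congr Complex; last by ring.
by rewrite mulrN opprK -!expr2 cos2Dsin2.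
Qed.

Lemma omegap : omega p = -1.
Proof.
rewrite /omega mulrC mulKf ?cospi ?sinpi ?pnatr_eq0 -?lt0n //.
by rewrite /GRing.opp /=; congr Complex; rewrite oppr0.
Qed.

Lemma omega_double_neq1 d : (0 < d < p)%N -> omega d.*2 != 1.
Proof.
move=> /andP[d0 dp]; rewrite -addnn omegaD -expr2 sqrf_eq1; apply/negP.
have pR : 0 < p%:R :> R by rewrite ltr0n.
have : 0 < complex.Im (omega d).
  rewrite /omega /=; apply: sin_gt0_pi; apply/andP; split.
    by rewrite divr_gt0 // mulr_gt0 ?ltr0n ?pi_gt0.
  by rewrite ltr_pdivrMr // mulrC ltr_pM2l ?pi_gt0 // ltr_nat.
by move=> + /orP[] /eqP e; rewrite e /= ?oppr0 ltxx.
Qed.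

Lemma sum_unity (x : C) : x ^+ p = 1 -> x != 1 -> \sum_(j < p) x ^+ j = 0.
Proof.
move=> xp x1; apply/eqP; have := subrX1 x p; rewrite xp subrr.
by move/esym/eqP; rewrite mulf_eq0 subr_eq0 (negbTE x1).
Qed.

Lemma sum_omega_double d : (0 < d < p)%N -> \sum_(j < p) omega 1 ^+ (d.*2 * j) = 0.
Proof.
move=> dp; under eq_bigr do rewrite exprM.
apply: sum_unity; last by rewrite -omegaE omega_double_neq1.
by rewrite -exprM mulnC exprM -omegaE omegap -mul2n exprM sqrrN !expr1n.
Qed.

(** The degrees differ by 2 d with 0 < d < p, and the powers of e^(2 d pi i / p),
    a p-th root of unity other than 1, sum to zero. *)
Lemma sum_omega_neq l m j k : (j < p)%N -> (k < p)%N -> l != m ->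
  (l + k.*2 = m + j.*2)%N ->
  \sum_(i < p) omega i ^+ l * conjc (omega i) ^+ m = 0.
Proof.
wlog : l m j k / (m < l)%N.
  move=> H jp kp lm e; have [ml|ml] := ltnP m l; first exact: (H l m j k).
  have := H m l k j _ kp jp _ (esym e); rewrite ltn_neqAle lm ml eq_sym => /(_ isT lm) h.
  move/(congr1 conjc) : h; rewrite rmorph_sum rmorph0 => h; rewrite -[RHS]h.
  apply: eq_bigr => i _.
  by move: (omega i) => w; rewrite rmorphM !rmorphXn /= conjcK mulrC.
move=> ml jp kp _ e.
have kj : (k < j)%N by rewrite -ltn_double -(ltn_add2l m) -e ltn_add2r.
have lE : (l = m + (j - k).*2)%N.
  by apply: (@addIn k.*2); rewrite e doubleB -addnA subnK // leq_double ltnW.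
rewrite (eq_bigr (fun i : 'I_p => omega 1 ^+ ((j - k).*2 * i))); last first.
  move=> i _; rewrite lE exprD mulrAC -exprMn omega_mulJ expr1n mul1r.
  by rewrite omegaE -exprM mulnC.
apply: sum_omega_double; rewrite subn_gt0 kj.
exact: leq_ltn_trans (leq_subr _ _) jp.
Qed.

Lemma sum_omega_eq l : \sum_(i < p) omega i ^+ l * conjc (omega i) ^+ l = p%:R.
Proof.
rewrite (eq_bigr (fun=> 1)) => [|i _]; first by rewrite sumr_const card_ord.
by rewrite -exprMn omega_mulJ expr1n.
Qed.

End rotations.

Section embedding.
Context (R : realType) (n : nat).
Local Notation C := R[i].

Definition emb (z : n.-tuple R) : 'rV[C]_n := \row_k Complex (tnth z k) 0.

Lemma rotE p j z : @Defs.rot R n p j z = omega R p j *: emb z.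
Proof. by apply/rowP => k; rewrite !mxE. Qed.

Lemma conj_emb z : map_mx conjc (emb z) = emb z.
Proof. by apply/rowP => k; rewrite !mxE /= oppr0. Qed.

Lemma sqnorm_emb z : sphere z -> polyfun (sqnorm n C) (emb z) = 1.
Proof.
move=> Sz; rewrite polyfun_sqnorm.
have := sqr_norm2 z; rewrite [norm2 z]Sz expr1n => h.
rewrite -[RHS](rmorph1 (real_complex R)) h rmorph_sum; apply: eq_bigr => i _.
by rewrite mxE rmorphXn.
Qed.

Lemma polyfun_conj (u : mpoly.mpoly n C) z :
  conjc (polyfun u (emb z)) = polyfun (mpoly.map_mpoly conjc u) (emb z).
Proof. by rewrite -[in RHS]conj_emb -polyfun_map. Qed.

Lemma polyf_mpoly (q : n.-tuple R -> R) : polyf q ->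
  exists u : mpoly.mpoly n C, forall z, polyfun u (emb z) = Complex (q z) 0.
Proof.
elim=> [c|i|f g _ [u uE] _ [v vE]|f g _ [u uE] _ [v vE]].
- by exists (mpoly.mpolyC n (Complex c 0)) => z; rewrite polyfunC.
- by exists (mpoly.mpolyX _ (mpoly.mnm1 i)) => z; rewrite polyfunX mxE.
- exists (1 *: u + v) => z; rewrite polyfunP mul1r uE vE.
  exact: esym (rmorphD (real_complex R) (f z) (g z)).
- exists (u * v) => z; rewrite polyfunM uE vE.
  exact: esym (rmorphM (real_complex R) (f z) (g z)).
Qed.

End embedding.

Section sphere_functional.
Context (R : realType) (n : nat).
Local Notation C := R[i].
Local Notation S := (@sphere R n).
Local Notation sigma := (@sphere_measure R n).
Local Notation poly := (mpoly.mpoly n C).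
Implicit Types u v : poly.

Definition cbfun (f : n.-tuple R -> C) :=
  bfun S (complex.Re (R:=R) \o f) /\ bfun S (complex.Im (R:=R) \o f).

Lemma cbfun_cst c : cbfun (fun=> c).
Proof. by split; exact: bfun_cst. Qed.

Lemma cbfunD f g : cbfun f -> cbfun g -> cbfun (fun z => f z + g z).
Proof.
move=> [f1 f2] [g1 g2]; split.
  rewrite (_ : _ \o _ = fun z => complex.Re (f z) + complex.Re (g z)).
    exact: bfunD.
  by apply/funext => z /=; case: (f z) (g z) => ? ? [].
rewrite (_ : _ \o _ = fun z => complex.Im (f z) + complex.Im (g z)).
  exact: bfunD.
by apply/funext => z /=; case: (f z) (g z) => ? ? [].
Qed.

Lemma cbfunM f g : cbfun f -> cbfun g -> cbfun (fun z => f z * g z).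
Proof.
move=> [f1 f2] [g1 g2]; split.
  rewrite (_ : _ \o _ = fun z => complex.Re (f z) * complex.Re (g z) -
      complex.Im (f z) * complex.Im (g z)).
    by apply: bfunB; exact: bfunM.
  by apply/funext => z /=; case: (f z) (g z) => ? ? [].
rewrite (_ : _ \o _ = fun z => complex.Re (f z) * complex.Im (g z) +
    complex.Im (f z) * complex.Re (g z)).
  by apply: bfunD; exact: bfunM.
by apply/funext => z /=; case: (f z) (g z) => ? ? [].
Qed.

Lemma cbfun_polyfun u a : cbfun (fun z => polyfun u (a *: emb z)).
Proof.
under eq_fun do rewrite polyfunE.
elim: (mpoly.msupp u) => [|m s IH].
  by under eq_fun do rewrite big_nil; exact: cbfun_cst.
under eq_fun do rewrite big_cons; apply: cbfunD => //.
apply: cbfunM; first exact: cbfun_cst.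
elim: (index_enum _) => [|i t IHt].
  by under eq_fun do rewrite big_nil; exact: cbfun_cst.
under eq_fun do rewrite big_cons; apply: cbfunM => //.
elim: (m i) => [|k IHk].
  by under eq_fun do rewrite expr0; exact: cbfun_cst.
under eq_fun do rewrite exprS; apply: cbfunM => //.
under eq_fun do rewrite !mxE; apply: cbfunM; first exact: cbfun_cst.
split; last exact: bfun_cst.
apply: polyf_bfun; last exact: polyf_coord.
by move=> z j; exact: sphere_coord_le1.
Qed.

Lemma csqint_polyfun u a : csqint (fun z => polyfun u (a *: emb z)).
Proof. by have [b1 b2] := cbfun_polyfun u a; exact: bounded_csqint. Qed.

Lemma L2_polyfun p u : L2 p (polyfun u).
Proof.
apply/L2P => j jp; under eq_fun do rewrite rotE; exact: csqint_polyfun.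
Qed.

Definition sphere_moment (m : mpoly.multinom n) : C :=
  Complex (\int[sigma]_(z in S) monomial (m : 'I_n -> nat) z) 0.

Lemma cintegral_polyfun u :
  cintegral (fun z => polyfun u (emb z)) = mfunctional sphere_moment u.
Proof.
under eq_fun do rewrite polyfunE.
have im (m : mpoly.multinom n) :
    cintegrable (fun z : n.-tuple R => Complex (monomial (m : 'I_n -> nat) z) 0).
  split.
    apply: (integrableS measurableT) => //; first exact: measurable_sphere.
    exact: (integrable_sphere_bounded (@measurable_monomial R n m)
      (@monomial_le1 R n m)).
  exact: integrable0.
have E m (z : n.-tuple R) : \prod_(i < n) emb z 0 i ^+ (m : mpoly.multinom n) i =
    Complex (monomial m z) 0.
  rewrite -[RHS]/(real_complex R _) rmorph_prod; apply: eq_bigr => i _.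
  by rewrite mxE rmorphXn.
have eI m : cintegral (fun z : n.-tuple R => Complex (monomial (m : mpoly.multinom n) z) 0) =
    sphere_moment m.
  by rewrite /cintegral /sphere_moment /= Rintegral_cst ?mul0r //; exact: measurable_sphere.
under eq_fun do under eq_bigr do rewrite E.
have cZ c (m : mpoly.multinom n) :
    cintegrable (fun z : n.-tuple R => c * Complex (monomial m z) 0) /\
    cintegral (fun z : n.-tuple R => c * Complex (monomial m z) 0) = c * sphere_moment m.
  have h1 := cintegrableP c (im m) (cintegrable0 R n).
  have h2 := cintegralP c (im m) (cintegrable0 R n).
  rewrite (_ : (fun _ => _ + _) =
    fun z : n.-tuple R => c * Complex (monomial m z) 0) in h1 h2; last first.
    by apply/funext => z; rewrite addr0.
  by rewrite h2 cintegral0 addr0 eI.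
have [|_ ->] := @cintegral_sum R n _ (mpoly.msupp u) (fun m z =>
  mpoly.mcoeff m u * Complex (monomial m z) 0).
  by move=> m; have [] := cZ (mpoly.mcoeff m u) m.
by apply: eq_bigr => m _; have [] := cZ (mpoly.mcoeff m u) m.
Qed.

Lemma mfunctional_sqnorm u :
  mfunctional sphere_moment (sqnorm n C * u) = mfunctional sphere_moment u.
Proof.
rewrite -!cintegral_polyfun; apply: eq_cintegral => z Sz.
by rewrite polyfunM sqnorm_emb // mul1r.
Qed.

(** By homogeneity the rotation j acts on u conj(v) as the scalar
    w_j^l conj(w_j)^m. *)
Lemma inner_polyfun p l m (u v : poly) :
  is_polyharmonic p l u -> is_polyharmonic p m v ->
  inner p (polyfun u) (polyfun v) =
  p%:R^-1 * (\sum_(j < p) omega R p j ^+ l * conjc (omega R p j) ^+ m) *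
  mfunctional sphere_moment (u * mpoly.map_mpoly conjc v).
Proof.
move=> [hu _] [hv _]; rewrite innerE; try exact: L2_polyfun.
rewrite -mulrA; congr (_ * _); rewrite mulr_suml; apply: eq_bigr => j _.
rewrite -cintegral_polyfun.
have iuv : cintegrable (fun z => polyfun (u * mpoly.map_mpoly conjc v) (emb z)).
  have := csqintM (csqint_polyfun u 1) (csqint_polyfun v 1).
  under eq_fun do rewrite !scale1r polyfun_conj -polyfunM.
  by [].
have := cintegralP (omega R p j ^+ l * conjc (omega R p j) ^+ m) iuv
  (cintegrable0 R n).
rewrite cintegral0 addr0 => <-; apply: eq_cintegral => z Sz.
rewrite addr0 !rotE !(polyfun_homogZ _ _ hu, polyfun_homogZ _ _ hv).
rewrite rmorphM rmorphXn polyfunM -polyfun_conj.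
by rewrite mulrACA.
Qed.

End sphere_functional.

(** * Orthogonality of the degrees and the zonal projection *)

Section polyharmonic_inner.
Context (R : realType) (p n : nat).
Hypothesis p0 : (0 < p)%N.
Hypothesis n0 : (0 < n)%N.
Local Notation C := R[i].
Local Notation S := (@sphere R n).
Local Notation poly := (mpoly.mpoly n C).
Local Notation L := (mfunctional (@sphere_moment R n)).
Local Notation B u v := (inner p (polyfun u) (polyfun v)).
Implicit Types (u v w : poly) (f g : 'rV[C]_n -> C).

Let M (k : nat) : C := Complex (gauss_moment R k) 0.
Let Cr (d : nat) : C := Complex (radial_gauss_moment R n d) 0.

Let M0 : M 0 != 0.
Proof. by rewrite (inj_eq (@complexI R) _ 0) gt_eqF // gauss_moment0_gt0. Qed.

Let M1 : M 1 = 0.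
Proof.
have := gauss_momentS R 0; rewrite mul0r => /eqP.
by rewrite mulf_eq0 pnatr_eq0 /= => /eqP e; rewrite /M e.
Qed.

Let MS k : M k.+2 *+ 2 = M k *+ k.+1.
Proof.
rewrite /M -[Complex _ _]/(real_complex R _) -[in RHS]/(real_complex R _).
rewrite -!rmorphMn; congr (real_complex R _).
rewrite -(mulr_natl (gauss_moment R k.+2) 2) -(mulr_natl (gauss_moment R k) k.+1).
exact: (gauss_momentS R k.+1).
Qed.

Let Cr0 d : Cr d != 0.
Proof. by rewrite (inj_eq (@complexI R) _ 0) radial_gauss_moment_neq0. Qed.

Let Crs (m : mpoly.multinom n) :
  \prod_(i < n) M (m i) = Cr (mpoly.mdeg m) * sphere_moment R m.
Proof.
rewrite /M /Cr /sphere_moment -(rmorph_prod (real_complex R)).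
rewrite (gauss_sphere_moment R n0 (fun i => m i)) rmorphM.
by rewrite (mpoly.mdegE m).
Qed.

Let Lp u : L2 p (polyfun u) := @L2_polyfun R n p u.

Lemma inner1_polyfun u v :
  inner 1 (polyfun u) (polyfun v) = L (u * mpoly.map_mpoly conjc v).
Proof.
rewrite innerE; try exact: L2_polyfun.
rewrite big_ord1 invr1 mul1r -cintegral_polyfun; apply: eq_cintegral => z _.
by rewrite rotE omega0 scale1r polyfunM polyfun_conj.
Qed.

Lemma map_mpolyJ u : mpoly.map_mpoly conjc (mpoly.map_mpoly conjc u) = u.
Proof. by apply/mpoly.mpolyP => m; rewrite !mpoly.mcoeff_map_mpoly; exact: conjcK. Qed.

(** A null vector is orthogonal to all polynomials on the sphere, but the
    pairing is nondegenerate in each degree. *)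
Lemma inner_polyharmonic_null m u : is_polyharmonic p m u -> B u u = 0 -> u = 0.
Proof.
move=> hu; rewrite (inner_polyfun hu hu) sum_omega_eq // mulVf ?mul1r; last first.
  by rewrite pnatr_eq0 -lt0n.
rewrite -inner1_polyfun => u0.
apply: (sphere_nondegenerate M0 M1 MS Crs hu.1) => v.
rewrite -(map_mpolyJ v) -inner1_polyfun.
by apply: inner_null => //; exact: L2_polyfun.
Qed.

(** Either two harmonic components have the same degree l - 2j = m - 2k, and the
    sum over the rotations vanishes, or none do, and the integral over the
    sphere vanishes. *)
Lemma inner_polyharmonic_orthogonal l m u v : l != m ->
  is_polyharmonic p l u -> is_polyharmonic p m v -> B u v = 0.
Proof.
move=> lm hu hv; rewrite (inner_polyfun hu hv).
have [[j [k [jp kp e]]]|H] := pselect (exists j k, [/\ (j < p)%N, (k < p)%N &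
    (l + k.*2 = m + j.*2)%N]).
  by rewrite (sum_omega_neq R p0 jp kp lm e) mulr0 mul0r.
rewrite (sphere_polyharmonic_orthogonal M1 MS Cr0 Crs (@mfunctional_sqnorm R n)
  n0 hu (map_mpoly_polyharmonic conjc hv)) ?mulr0 //.
by move=> j k jp kp; apply/negP => /eqP e; apply: H; exists j, k.
Qed.

Lemma polyfun_lin a u v :
  polyfun (a *: u + v) = fun x => a * polyfun u x + polyfun v x.
Proof. by apply/funext => x; exact: polyfunP. Qed.

Lemma inner_polyfun_lin a u v g : L2 p g ->
  inner p (polyfun (a *: u + v)) g = a * inner p (polyfun u) g + inner p (polyfun v) g.
Proof.
by move=> Lg; rewrite polyfun_lin innerP //; exact: Lp.
Qed.

Lemma inner_polyfun0 g : L2 p g -> inner p (polyfun (0 : poly)) g = 0.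
Proof.
move=> Lg; have := inner_polyfun_lin (-1) 0 0 Lg.
by rewrite scaler0 addr0 mulN1r addNr.
Qed.

Lemma inner_polyfun_sum (I : Type) (s : seq I) (F : I -> poly) g : L2 p g ->
  inner p (polyfun (\sum_(i <- s) F i)) g = \sum_(i <- s) inner p (polyfun (F i)) g.
Proof.
move=> Lg; elim: s => [|i s IH]; first by rewrite !big_nil inner_polyfun0.
by rewrite !big_cons -[F i in LHS]scale1r inner_polyfun_lin // mul1r IH.
Qed.

Lemma riesz_polyharmonic m (l : poly -> C) : linear_for *%R l ->
    (forall u, is_polyharmonic p m u -> B u u = 0 -> l u = 0) ->
  exists2 w, is_polyharmonic p m w &
    forall u, is_polyharmonic p m u -> l u = B u w.
Proof.
move=> ll l0; have [s [sH Hs]] := polyharmonic_span C p m n0.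
have spanH u : inspan s u -> is_polyharmonic p m u.
  move=> su; apply: su => // [|a x y]; first exact: polyharmonic0.
  exact: polyharmonicP.
have [w sw lw] := @riesz C _ (@conjc R) (fun u v => inner p (polyfun u) (polyfun v))
  (@conjcK R)
  (fun a u v w => inner_polyfun_lin a u v (Lp w))
  (fun u v => inner_conj (Lp u) (Lp v))
  (fun u v => inner_null (Lp u) (Lp v)) s l ll
  (fun u su => l0 u (spanH u su)).
exists w; first exact: spanH.
by move=> u hu; apply: lw; exact: Hs.
Qed.

Lemma polyharmonic_Shat_polyfun m u : is_polyharmonic p m u ->
  polyharmonic_Shat p m (patch (fun=> 0) (Shat p) (polyfun u)).
Proof. by move=> hu; exists u. Qed.

Lemma patch_Shat f x : Shat p x -> patch (fun=> 0) (Shat p) f x = f x.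
Proof. by move=> Sx; rewrite /patch mem_set. Qed.

Lemma zonal_exists m (eta : 'rV[C]_n) : Shat p eta -> exists Z, is_zonal p m eta Z.
Proof.
move=> Se; have [u v w|u hu u0|w hw lw] :=
  @riesz_polyharmonic m (fun u => polyfun u eta).
- exact: polyfunP.
- by rewrite (inner_polyharmonic_null hu u0) /polyfun mpoly.meval0.
exists (patch (fun=> 0) (Shat p) (polyfun w)); split.
  exact: polyharmonic_Shat_polyfun.
move=> _ [u hu <-]; rewrite patch_Shat // lw //.
by apply: eq_inner => x Sx; rewrite patch_Shat.
Qed.

(** The projection w of f to H_m represents u |-> <u, f> on H_m; taking for u the
    zonal polyharmonic at eta gives <f, Z> = <w, Z> = w(eta). *)
Lemma zonal_projection f m : L2 p f -> exists w,
  [/\ is_polyharmonic p m w,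
      forall u, is_polyharmonic p m u -> inner p (polyfun u) f = B u w &
      forall eta, Shat p eta -> inner p f (zonal p m eta) = polyfun w eta].
Proof.
move=> Lf.
have [u v w|u hu u0|w hw lw] :=
  @riesz_polyharmonic m (fun u => inner p (polyfun u) f).
- by move=> /=; rewrite inner_polyfun_lin.
- by rewrite inner_null //; exact: Lp.
exists w; split => // eta Se.
have [Z0 zZ0] := zonal_exists m Se.
have [[u hu Zu] repr] : is_zonal p m eta (zonal p m eta).
  exact: (@xgetPex _ _ [set Z | is_zonal p m eta Z] (ex_intro _ Z0 zZ0)).
have E (g : 'rV[C]_n -> C) : inner p g (zonal p m eta) = inner p g (polyfun u).
  by apply: eq_inner => // x Sx; rewrite -Zu patch_Shat.
have := repr _ (polyharmonic_Shat_polyfun hw); rewrite patch_Shat // => ->.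
rewrite E (inner_conj (Lp u) Lf) lw // -inner_conj; try exact: Lp.
by apply: eq_inner => x Sx; rewrite ?patch_Shat // -Zu patch_Shat.
Qed.

End polyharmonic_inner.

(** * Polyharmonics separate the rotated spheres *)

Section polyharmonic_sums.
Context (R : realType) (p n : nat).
Hypothesis p0 : (0 < p)%N.
Hypothesis n0 : (0 < n)%N.
Local Notation C := R[i].
Local Notation S := (@sphere R n).
Local Notation poly := (mpoly.mpoly n C).
Local Notation omega := (omega R p).
Local Notation rot := (@Defs.rot R n p).
Implicit Types (u v w : poly) (f g : 'rV[C]_n -> C).

Inductive polysum : poly -> Prop :=
| polysum_polyharmonic m u : is_polyharmonic p m u -> polysum u
| polysum_lin a u v : polysum u -> polysum v -> polysum (a *: u + v).

Lemma polysum0 : polysum 0.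
Proof. exact: (polysum_polyharmonic (polyharmonic0 _ _ p 0)). Qed.

Lemma polysum_sum (I : Type) (s : seq I) (c : I -> C) (F : I -> poly) :
  (forall i, polysum (F i)) -> polysum (\sum_(i <- s) c i *: F i).
Proof.
move=> sF; elim: s => [|i s IH]; first by rewrite big_nil; exact: polysum0.
by rewrite big_cons; exact: polysum_lin.
Qed.

Lemma omega_mulJB j k : (j <= k)%N -> omega k * conjc (omega j) = omega (k - j).
Proof.
by move=> jk; rewrite -{1}(subnK jk) omegaD -mulrA omega_mulJ mulr1.
Qed.

Lemma omega_double_expp j : omega j.*2 ^+ p = 1.
Proof.
by rewrite omegaE -exprM mulnC exprM -omegaE omegap // -mul2n exprM sqrrN !expr1n.
Qed.

(** Orthogonality of the characters l |-> omega_j^(2l) of Z/p, for j < p. *)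
Lemma sum_omega_delta (j k : 'I_p) :
  \sum_(l < p) ((omega j * conjc (omega k)) ^+ 2) ^+ l = p%:R * (j == k)%:R.
Proof.
have [->|jk] := eqVneq j k.
  rewrite omega_mulJ expr1n mulr1.
  by under eq_bigr do rewrite expr1n; rewrite sumr_const card_ord.
have H i : (0 < i < p)%N -> \sum_(l < p) (omega i ^+ 2) ^+ l = 0.
  move=> ip; rewrite expr2 -omegaD addnn; apply: sum_unity.
    exact: omega_double_expp.
  exact: omega_double_neq1.
rewrite mulr0; have [lt|gt|e] := ltngtP j k; last by rewrite (val_inj e) eqxx in jk.
  have E : conjc (omega j * conjc (omega k)) = omega (k - j).
    rewrite -(omega_mulJB (ltnW lt)); move: (omega j) (omega k) => x y.
    by rewrite rmorphM /= conjcK mulrC.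
  rewrite -[LHS]conjcK rmorph_sum.
  under eq_bigr do rewrite !rmorphXn [X in (X ^+ 2) ^+ _]E.
  rewrite H ?rmorph0 // subn_gt0 lt.
  exact: leq_ltn_trans (leq_subr _ _) (ltn_ord k).
rewrite (omega_mulJB (ltnW gt)); apply: H; rewrite subn_gt0 gt.
exact: leq_ltn_trans (leq_subr _ _) (ltn_ord j).
Qed.

(** For u = |x|^(2i) h, which is h on the sphere, the coefficients are those of
    the inverse Fourier transform on Z/p. *)
Lemma polysum_separate (k : 'I_p) u : exists2 U, polysum U &
  forall (j : 'I_p) z, S z ->
    polyfun U (rot j z) = (j == k)%:R * polyfun u (emb z).
Proof.
move: u; apply: (@harmonic_ind n C _ n0) => [|a u v [U sU eU] [V sV eV]|d i h hh h0].
- exists 0; first exact: polysum0.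
  by move=> j z _; rewrite /polyfun !mpoly.meval0 mulr0.
- exists (a *: U + V); first exact: polysum_lin.
  by move=> j z Sz; rewrite !polyfunP eU // eV // mulrDr mulrCA.
pose r := sqnorm n C.
have r1 l z : S z -> polyfun (r ^+ l * h) (emb z) = polyfun h (emb z).
  move=> Sz; rewrite polyfunM; suff -> : polyfun (r ^+ l) (emb z) = 1 by rewrite mul1r.
  elim: l => [|l IH]; first by rewrite expr0 -mpoly.mpolyC1 polyfunC.
  by rewrite exprS polyfunM IH sqnorm_emb // mulr1.
exists (\sum_(l < p) (p%:R^-1 * conjc (omega k) ^+ (d + l.*2)) *: (r ^+ l * h)).
  apply: polysum_sum => l; apply: polysum_polyharmonic.
  exact: (radial_polyharmonic (ltn_ord l) hh h0).
move=> j z Sz; rewrite r1 //.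
rewrite polyfun_sum (eq_bigr (fun l : 'I_p => p%:R^-1 * (omega j * conjc (omega k)) ^+ d *
   polyfun h (emb z) * ((omega j * conjc (omega k)) ^+ 2) ^+ l)) => [|l _]; last first.
  have [hl _] := radial_polyharmonic (ltn_ord l) hh h0.
  rewrite [LHS]mpoly.mevalZ -/(polyfun _ _) rotE (polyfun_homogZ _ _ hl) r1 // -exprM mul2n.
  move: (omega j) (conjc (omega k)) (polyfun h _) (p%:R^-1) => x y b c.
  by rewrite !exprMn !exprD; ring.
rewrite -mulr_sumr sum_omega_delta; have [->|_] := eqVneq j k; last by rewrite !mulr0 mul0r.
rewrite omega_mulJ expr1n !mulr1 mul1r mulrAC mulVf ?mul1r //.
by rewrite pnatr_eq0 -lt0n.
Qed.

End polyharmonic_sums.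

(** * Density of the sums of polyharmonics *)

Section polyharmonic_density.
Context (R : realType) (p n : nat).
Hypothesis p0 : (0 < p)%N.
Hypothesis n0 : (0 < n)%N.
Local Notation C := R[i].
Local Notation S := (@sphere R n).
Local Notation sigma := (@sphere_measure R n).
Local Notation poly := (mpoly.mpoly n C).
Local Notation rot := (@Defs.rot R n p).
Local Notation Re := (@complex.Re R).
Local Notation Im := (@complex.Im R).
Implicit Types (u v w U : poly) (f g : 'rV[C]_n -> C).

Let Lp u : L2 p (polyfun u) := @L2_polyfun R n p u.

Lemma cintegral_dist2 (h q : n.-tuple R -> C) : csqint h -> csqint q ->
  cintegral (fun z => (h z - q z) * conjc (h z - q z)) =
  real_complex R (dist2 sigma S (Re \o h) (Re \o q) + dist2 sigma S (Im \o h) (Im \o q)).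
Proof.
move=> [h1 h2] [q1 q2]; rewrite /dist2 -RintegralD //; last 3 first.
- exact: measurable_sphere.
- by have [_] := sqintB (@measurable_sphere R n) h1 q1.
- by have [_] := sqintB (@measurable_sphere R n) h2 q2.
rewrite /cintegral /real_complex_def; congr Complex.
  apply: eq_Rintegral => z _ /=.
  by case: (h z) (q z) => a b [c d] /=; ring.
rewrite (@eq_Rintegral _ _ _ _ _ (fun=> 0)) => [|z _].
  by rewrite Rintegral_cst ?mul0r //; exact: measurable_sphere.
by case: (h z) (q z) => a b [c d] /=; ring.
Qed.

Lemma inner_pythagoras f g : L2 p f -> L2 p g -> inner p f g = 0 ->
  inner p (fun x => 1 * f x + g x) (fun x => 1 * f x + g x) =
  inner p f f + inner p g g.
Proof.
move=> Lf Lg fg; have Lh := L2_lin 1 Lf Lg.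
have gf : inner p g f = 0 by rewrite (inner_conj Lf Lg) fg; exact: rmorph0.
rewrite innerP // mul1r (inner_conj Lh Lf) (inner_conj Lh Lg) !innerP //.
by rewrite fg gf !mulr0 !mul1r addr0 add0r -!inner_conj.
Qed.

(** Approximate f by a polynomial on each of the rotated spheres. The difference
    f - U has the shape a U + f of [L2_lin] and [innerP]. *)
Lemma polysum_dense f (e : R) : L2 p f -> 0 < e -> exists2 U, polysum p U &
  Re (inner p (fun x => - 1 * polyfun U x + f x) (fun x => - 1 * polyfun U x + f x)) <= e.
Proof.
move=> Lf e0.
have Lf' := L2P p f; have {}Lf' := Lf'.1 Lf.
have approx (j : 'I_p) : exists u, 
  dist2 sigma S (fun z => Re (f (rot j z))) (fun z => Re (polyfun u (emb z))) +
  dist2 sigma S (fun z => Im (f (rot j z))) (fun z => Im (polyfun u (emb z))) <= e.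
  have [f1 f2] := Lf' j (ltn_ord j).
  have e2 : 0 < e / 2 by rewrite divr_gt0.
  have dens := polyf_dense (@measurable_sphere R n) (@sphere_coord_le1 R n).
  have [a /(@polyf_mpoly R n)[u ua] da] := dens sigma _ _ f1 e2.
  have [b /(@polyf_mpoly R n)[v vb] db] := dens sigma _ _ f2 e2.
  exists (Complex 0 1 *: v + u).
  under [X in dist2 _ _ _ X + _]eq_fun do rewrite polyfunP ua vb.
  under [X in _ + dist2 _ _ _ X]eq_fun do rewrite polyfunP ua vb.
  apply: le_trans (_ : e / 2 + e / 2 <= e); last by lra.
  apply: lerD.
    apply: le_trans da; rewrite le_eqVlt; apply/orP; left; apply/eqP.
    by congr (dist2 _ _ _ _); apply/funext => z /=; ring.
  apply: le_trans db; rewrite le_eqVlt; apply/orP; left; apply/eqP.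
  by congr (dist2 _ _ _ _); apply/funext => z /=; ring.
have [q hq] := choice approx.
have [U hU] := choice (fun k : 'I_p => (exists2P _ _).1 (polysum_separate p0 n0 k (q k))).
pose V := \sum_(k < p) 1 *: U k.
have VE (j : 'I_p) z : S z -> polyfun V (rot j z) = polyfun (q j) (emb z).
  move=> Sz; rewrite polyfun_sum (bigD1 j) //= big1 => [|k kj].
    by have [_ Uj] := hU j; rewrite scale1r Uj // eqxx mul1r addr0.
  by have [_ Uk] := hU k; rewrite scale1r Uk // eq_sym (negbTE kj) mul0r.
exists V; first by apply: polysum_sum => k; have [] := hU k.
have Lg := L2_lin (-1) (Lp V) Lf.
have E (j : 'I_p) : cintegral (fun z => (- 1 * polyfun V (rot j z) + f (rot j z)) *
   conjc (- 1 * polyfun V (rot j z) + f (rot j z))) = real_complex R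
  (dist2 sigma S (fun z => Re (f (rot j z))) (fun z => Re (polyfun (q j) (emb z))) +
  dist2 sigma S (fun z => Im (f (rot j z))) (fun z => Im (polyfun (q j) (emb z)))).
  rewrite -[RHS](cintegral_dist2 (Lf' j (ltn_ord j))); last first.
    by have := csqint_polyfun (q j) 1; under eq_fun do rewrite scale1r.
  apply: eq_cintegral => z Sz; rewrite VE //.
  by rewrite mulN1r addrC.
rewrite innerE //; under eq_bigr do rewrite E.
rewrite -(rmorph_nat (real_complex R)) -fmorphV -rmorph_sum -rmorphM /=.
rewrite mulrC ler_pdivrMr ?ltr0n //.
apply: (@le_trans _ _ (\sum_(j < p) e)); first by apply: ler_sum => j _.
by rewrite sumr_const card_ord mulr_natr.
Qed.

End polyharmonic_density.

Theorem theorem3 (R : realType) (p n : nat) (hp : (1 <= p)%N) (hn : (2 <= n)%N)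
  (f : 'rV[R[i]]_n -> R[i]) (hf : L2 p f) :
  (forall m : nat, L2 p (fun eta => inner p f (zonal p m eta))) /\
  (fun N : nat => L2norm p (fun eta =>
     f eta - \sum_(m < N) inner p f (zonal p m eta))) @ \oo --> (0 : R).
Proof.
have n0 : (0 < n)%N := ltnW hn.
have [w hw] := choice (fun m => zonal_projection hp n0 m hf).
have Lp (u : mpoly.mpoly n R[i]) : L2 p (polyfun u) := @L2_polyfun R n p u.
split=> [m|].
  have [_ _ wE] := hw m.
  by apply: (eq_L2 (f := polyfun (w m))) => // x Sx; rewrite wE.
pose P N := \sum_(m < N) w m.
pose g N x := - 1 * polyfun (P N) x + f x.
have Lg N : L2 p (g N) by exact: L2_lin.
have gE N : L2norm p (fun eta => f eta - \sum_(m < N) inner p f (zonal p m eta)) =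
    Num.sqrt (complex.Re (inner p (g N) (g N))).
  rewrite /L2norm; have E x : Shat p x ->
    f x - \sum_(m < N) inner p f (zonal p m x) = g N x.
    move=> Sx; rewrite /g mulN1r addrC /P; congr (- _ + _).
    rewrite polyfun_sum; apply: eq_bigr => m _ /=.
    by have [_ _ ->] := hw m.
  by congr (Num.sqrt (complex.Re _)); exact: eq_inner.
have g_orth m u N : (m < N)%N -> is_polyharmonic p m u -> inner p (polyfun u) (g N) = 0.
  move=> mN hu; have [hwm wE _] := hw m.
  rewrite (inner_conj (Lg N) (Lp u)) innerP // inner_polyfun_sum //.
  rewrite (bigD1 (Ordinal mN)) //= big1 => [|i im]; last first.
    by have [hwi _ _] := hw i; apply: (inner_polyharmonic_orthogonal hp n0 _ hwi hu).
  rewrite addr0 (inner_conj (Lp u) hf) wE // -inner_conj // mulN1r addNr.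
  exact: rmorph0.
have g_polysum U : polysum p U -> exists N0, forall N, (N0 <= N)%N ->
    inner p (polyfun U) (g N) = 0.
  elim=> [m u hu|a u v _ [N1 h1] _ [N2 h2]].
    by exists m.+1 => N mN; exact: g_orth hu.
  exists (maxn N1 N2) => N; rewrite geq_max => /andP[n1 n2].
  by rewrite inner_polyfun_lin // h1 // h2 // mulr0 addr0.
apply/cvgr0Pnorm_le => e e0.
have [U sU Ue] := polysum_dense hp n0 hf (exprn_gt0 2 e0).
have [N0 hN0] := g_polysum U sU.
near=> N.
have NN0 : (N0 <= N)%N by near: N; exact: nbhs_infty_ge.
rewrite gE ger0_norm ?sqrtr_ge0 //.
rewrite -[leRHS](gtr0_norm e0) -(sqrtr_sqr e).
apply: ler_wsqrtr; apply: (le_trans _ Ue).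
(* g N is orthogonal to P N - U, hence not longer than their sum f - U *)
have D0 : inner p (polyfun (- 1 *: U + P N)) (g N) = 0.
  rewrite inner_polyfun_lin // hN0 // mulr0 add0r inner_polyfun_sum // big1 // => m _.
  by have [hm _ _] := hw m; exact: g_orth hm.
have hE : (fun x => - 1 * polyfun U x + f x) =
    (fun x => 1 * polyfun (- 1 *: U + P N) x + g N x).
  by apply/funext => x; rewrite polyfunP /g; ring.
rewrite hE inner_pythagoras // raddfD /= lerDr.
by have := inner_ge0 (Lp (- 1 *: U + P N)); rewrite lecE => /andP[].
Unshelve. all: by end_near.
Qed.
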